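(* Let $\Omega$ be a countably infinite set with transition rates $\gamma_{i\to j}\ge0$ ($\gamma_{i\to i}=0$) and associated generator $\Gamma$ with $\sum_{i,j\in\Omega}|\Gamma^{(i,j)}|<\infty$. Suppose the network of the master equation $\dot P=\Gamma P$ is irreducible, positive recurrent and satisfies the generalized detailed balance condition. Then, for every probability vector $P_0$ on $\Omega$, the stationary solutions of the finite dimensional master equations converge in the thermodynamic limit to the stationary solution $P_*$ of the infinite dimensional master equation: $$P^F_\infty(P_0^{[F]})\longrightarrow P_*\quad\text{in }\|\cdot\|_1$$ along the net of finite sets $F\subseteq\Omega$ with $P_0(F)>0$, ordered by inclusion.
   Context: A probability vector is $P\in[0,\infty)^\Omega$ with $\|P\|_1=\sum_\omega P^{(\omega)}=1$; for $A\subseteq\Omega$, $P(A)=\sum_{a\in A}P^{(a)}$. Generator: $\Gamma^{(i,j)}=\gamma_{j\to i}$ for $i\ne j$ and $\Gamma^{(j,j)}=-\sum_{k}\gamma_{j\to k}$. The network is the directed graph on $\Omega$ with a link $i\to j$ whenever $\gamma_{i\to j}>0$; irreducible means strongly connected. Positive recurrent: for the continuous-time Markov chain $(X_t)$ with $\mathbb P(X_t=i\mid X_0=j)=(e^{t\Gamma})^{(i,j)}$ and every initial state $X_0=\omega_0$, the return time $t_R=\inf\{t>0:X_t=\omega_0\text{ and }X_\tau\ne\omega_0\text{ for some }\tau\in(0,t)\}$ is almost surely finite and has finite expectation. An irreducible, positive recurrent master equation has a unique stationary solution, i.e. a unique probability vector $P_*$ with $\Gamma P_*=0$. Generalized detailed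 balance: there exists $X_*\in(0,\infty)^\Omega$ (not necessarily summable) with $X_*^{(j)}\gamma_{j\to i}=X_*^{(i)}\gamma_{i\to j}$ for all $i\ne j$ in $\Omega$. For finite $F\subseteq\Omega$, $\Gamma^{[F]}$ is the $\Omega\times\Omega$ matrix with $(\Gamma^{[F]})^{(i,j)}=\gamma_{j\to i}$ if $i\neq j$, $i,j\in F$; $(\Gamma^{[F]})^{(j,j)}=-\sum_{f\in F}\gamma_{j\to f}$ if $j\in F$; all other entries $0$. For finite $F$ with $P_0(F)>0$, $P_0^{[F]}$ has entries $P_0^{(i)}/P_0(F)$ for $i\in F$ and $0$ otherwise, and $P^F_\infty(P_0^{[F]}):=\lim_{t\to\infty}e^{t\Gamma^{[F]}}P_0^{[F]}$ (this limit always exists, the problem being finite dimensional). *)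

(* Defs.v *)
(* Vectors indexed by Omega are
   functions Omega -> R and Omega x Omega matrices are functions
   Omega -> Omega -> R; the rate of the transition i -> j is gamma i j, while
   matrices act on column vectors, so that the entry (i, j) of a generator
   concerns the transition j -> i. *)
From HB Require Import structures.
From mathcomp Require Export all_boot all_order all_algebra finmap.
From mathcomp Require Export all_classical all_reals all_analysis.

Set Implicit Arguments.
Unset Strict Implicit.
Unset Printing Implicit Defensive.

Import Order.TTheory GRing.Theory Num.Theory.
Export numFieldNormedType.Exports.

Local Open Scope classical_set_scope.
Local Open Scope ring_scope.

Section Vectors.
Context {R : realType} {Omega : choiceType}.
Implicit Types (f P : Omega -> R) (A B : Omega -> Omega -> R) (F : {fset Omega}).

(* Unordered sum of an absolutely summable real family: the difference of the
   sums of its positive and negative parts (esum is for nonnegative terms). *)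
Definition usum f : R :=
  fine (esum [set: Omega] (EFin \o f)^\+ - esum [set: Omega] (EFin \o f)^\-)%E.

Definition l1norm f : \bar R := (\esum_(i in [set: Omega]) `|f i|%:E)%E.

Definition matvec A P : Omega -> R := fun i => usum (fun j => A i j * P j).

Definition matmul A B : Omega -> Omega -> R :=
  fun i j => usum (fun k => A i k * B k j).

Definition matid : Omega -> Omega -> R := fun i j => (i == j)%:R.

Definition matpow A (n : nat) : Omega -> Omega -> R := iter n (matmul A) matid.

(* exp_coeff t n = t ^+ n / n`!, so this is the exponential series of t A,
   taken entrywise. *)
Definition matexp (t : R) A : Omega -> Omega -> R :=
  fun i j => limn (series (fun n => exp_coeff t n * matpow A n i j)).

Definition prob_vector P : Prop := (forall i, 0 <= P i) /\ l1norm P = 1%E.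

Definition mass P F : R := \sum_(i <- F) P i.

Definition stationary A P : Prop :=
  prob_vector P /\ forall i, matvec A P i = 0.

End Vectors.

Section Network.
Context {R : realType} {Omega : choiceType}.
Implicit Types (gamma : Omega -> Omega -> R) (P : Omega -> R).
Implicit Types (F : {fset Omega}).

(* If the diagonal sum diverges then usum is a junk value, but in that case
   abs_summable below fails because of the off-diagonal entries. *)
Definition generator gamma : Omega -> Omega -> R :=
  fun i j => if i == j then - usum (gamma j) else gamma j i.

Definition abs_summable (A : Omega -> Omega -> R) : Prop :=
  (\esum_(ij in [set: Omega * Omega]) `|A ij.1 ij.2|%:E < +oo)%E.

Definition irreducible gamma : Prop :=
  forall i j, exists2 p : seq Omega,
    path (fun k l => 0 < gamma k l) i p & last i p = j.

Definition generalized_detailed_balance gamma : Prop :=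
  exists2 Xs : Omega -> R, (forall i, 0 < Xs i) &
    forall i j, i != j -> Xs j * gamma j i = Xs i * gamma i j.

Definition generator_on gamma F : Omega -> Omega -> R := fun i j =>
  if (i \in F) && (j \in F) then
    if i == j then - \sum_(f <- F) gamma j f else gamma j i
  else 0.

Definition restrict_prob P F : Omega -> R :=
  fun i => if i \in F then P i / mass P F else 0.

(* The vectors below vanish outside the finite set F, so that the limit can be
   taken entrywise. *)
Definition limit_on gamma F P : Omega -> R := fun i =>
  lim (matvec (matexp t (generator_on gamma F)) P i @[t --> +oo]).

(* Tails of the net of finite sets F with P(F) > 0, ordered by inclusion. *)
Definition finite_net P : set_system {fset Omega} :=
  filter_from [set F0 : {fset Omega} | 0 < mass P F0]
    (fun F0 => [set F : {fset Omega} | 0 < mass P F /\ (F0 `<=` F)%fset]).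

End Network.

Section MarkovChain.
Context {R : realType} {Omega : choiceType}.

(* X : R -> T -> Omega, of which only the times t >= 0 are relevant, is a
   continuous-time Markov chain started at i0 with right-continuous paths for
   the discrete topology of Omega, and
   P(X_(s+t) = i | X_s = j, X_u = k for (u, k) in us) = e^(tA)(i, j)
   for all past observations us at times in [0, s]; conditional probabilities
   are multiplied out in order to allow for null events. *)
Definition markov_chain (A : Omega -> Omega -> R) (i0 : Omega)
    (d : measure_display) (T : measurableType d) (P : probability T R)
    (X : R -> T -> Omega) : Prop :=
  [/\ forall t i, 0 <= t -> measurable (X t @^-1` [set i]),
      forall w t, 0 <= t -> \forall s \near t^'+, X s w = X t w,
      P (X 0 @^-1` [set i0]) = 1%E &
      forall (s t : R) (i j : Omega) (us : seq (R * Omega)),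
        0 <= s -> 0 <= t -> (forall u, u \in us -> 0 <= u.1 <= s) ->
        let present_past :=
          X s @^-1` [set j] `&` [set w | forall u, u \in us -> X u.1 w = u.2] in
        P (X (s + t) @^-1` [set i] `&` present_past) =
        ((matexp t A i j)%:E * P present_past)%E].

(* +oo when the set is empty *)
Definition return_time (i0 : Omega) (T : Type) (X : R -> T -> Omega) (w : T) :
    \bar R :=
  ereal_inf [set t%:E | t in
    [set t : R | [/\ 0 < t, X t w = i0 &
                     exists2 tau, 0 < tau < t & X tau w <> i0]]].

(* The chain started at i0 is determined up to its law by its transition
   matrix; it is given here by some realization on a probability space. *)
Definition positive_recurrent (A : Omega -> Omega -> R) : Prop :=
  forall i0 : Omega,
  exists (d : measure_display) (T : measurableType d) (P : probability T R)
         (X : R -> T -> Omega),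
    [/\ markov_chain A i0 P X,
        \forall w \ae P, (return_time i0 X w < +oo)%E &
        (\int[P]_w return_time i0 X w < +oo)%E].

End MarkovChain.

(* Main.v *)
(* Write X for the detailed balance vector.

   Summability of X.  Observe the chain started at a state o on the grid of step
   h.  By the Markov property the visits to o form a renewal process; counting by
   the last visit to o before time N gives 1 = sum_(k <= N) p(k) v(N - k), where
   p(k) is the probability to be in o at step k and v(n) that of avoiding o
   during the n steps after a visit.  As h -> 0, the finite mean return time
   bounds sum_n v(n), so the time averages of p stay above some 1 / C.  Let u be
   the density with respect to X of the time-averaged law of the chain.  By
   reversibility u is bounded and its Dirichlet form is O(1 / time), so u becomes
   constant along links, hence on every finite set; as u(o) >= 1 / (C X(o)) and
   the averaged law has mass at most 1, the sum of X is at most 2 C X(o).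

   Finite systems.  For a finite F, the flow is self-adjoint for the inner
   product weighted by 1 / X, and its energies decrease; polarization shows that
   it converges.  The limit is proportional to X on each connected component of
   F, with the mass that the initial vector puts on that component.  For large F
   one component carries almost all the mass of P_0 and of P_*. *)
Require Import Defs.
From mathcomp Require Import measurable_realfun ring lra zify.

Set Implicit Arguments.
Unset Strict Implicit.
Unset Printing Implicit Defensive.
Import Order.TTheory GRing.Theory Num.Theory.

Local Open Scope classical_set_scope.
Local Open Scope ring_scope.

(** * Unordered sums *)

(** Recurrence and the Markov property serve only the summability of [X]. The transition matrix is
    an entrywise exponential series, so its positivity, its column sums and half of
    Chapman-Kolmogorov are read off realizations of the chain, one for each initial state. The
    delicate point is uniformity in the mesh h. An excursion from o lasts about 1 / h grid steps, so
    the sum of v(n) stays bounded only because a grid visit is followed by an exit with probability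
    O(h). This is exploited backwards: the event of no return by step N contains, for each k, a
    first sojourn of k steps followed by avoidance, and about 1 / h values of k have sojourn
    probability at least 1/2. A fixed grid can miss excursions and returns. Dyadic grids are nested,
    so the no-return events decrease under refinement, and right-continuity of the paths ties their
    intersection to the true return time; the mesh is then chosen after the time horizon. Uniqueness
    of the stationary vector is separate: it compares the balance equations of two stationary
    vectors, using that all rates together have a finite sum. *)

Section UnorderedSums.
Context {R : realType}.

Lemma esum_ge_fset (I : choiceType) (f : I -> R) (F : {fset I}) :
  (forall i, 0 <= f i) ->
  ((\sum_(i <- F) f i)%:E <= \esum_(i in [set: I]) (f i)%:E)%E.
Proof.
move=> f0; apply: esum_ge; exists [set` F]; first by split.
by rewrite fsbig_finite//= set_fsetK sumEFin.
Qed.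

Lemma esum_le_fset (I : choiceType) (f : I -> \bar R) (M : \bar R) :
  (forall F : {fset I}, (\sum_(i <- F) f i <= M)%E) ->
  (\esum_(i in [set: I]) f i <= M)%E.
Proof.
move=> fM; apply: ge_ereal_sup => _ [X [finX _]] <-.
by rewrite fsbig_finite.
Qed.

Lemma esum_fset_support (I : choiceType) (f : I -> \bar R) (F : {fset I}) :
  (forall i, 0 <= f i)%E -> (forall i, i \notin F -> f i = 0%E) ->
  \esum_(i in [set: I]) f i = (\sum_(i <- F) f i)%E.
Proof.
move=> f0 fF; transitivity (\esum_(i in [set` F]) f i).
  rewrite [RHS]esum_mkcond; apply: eq_esum => i _; case: ifPn => // iF.
  by apply: fF; apply: contra iF => iF; apply/mem_set.
rewrite -[RHS](_ : \sum_(i \in [set` F]) f i = _)%E; last first.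
  by rewrite fsbig_finite//= set_fsetK.
rewrite -esum_fset//.
Qed.

Lemma esum_ge1 (I : choiceType) (f : I -> \bar R) i :
  (forall i, 0 <= f i)%E -> (f i <= \esum_(i in [set: I]) f i)%E.
Proof.
move=> f0; rewrite -[leLHS](esum_set1 (f0 i)).
rewrite (esumID [set i] setT)// setTI leeDl//.
by apply: esum_ge0.
Qed.

Lemma esum_exchange (I J : choiceType) (f : I -> J -> \bar R) :
  (forall i j, 0 <= f i j)%E ->
  \esum_(i in [set: I]) \esum_(j in [set: J]) f i j =
  \esum_(j in [set: J]) \esum_(i in [set: I]) f i j.
Proof.
move=> f0; rewrite esum_esum// esum_esum//.
rewrite (reindex_esum [set: J * I] ([set: I] `*`` fun=> [set: J]) (fun p => (p.2, p.1)))//=; last first.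
  split => //=.
  - by move=> [x1 x2] [y1 y2] _ _ /= [-> ->].
  - by move=> [x1 x2] _; exists (x2, x1).
congr esum; apply/seteqP; split => //.
Qed.

Lemma esumZ (I : choiceType) (f : I -> \bar R) (c : R) :
  0 <= c -> (forall i, 0 <= f i)%E ->
  \esum_(i in [set: I]) (c%:E * f i)%E = (c%:E * \esum_(i in [set: I]) f i)%E.
Proof.
have aux (d : R) (g : I -> \bar R) : 0 <= d -> (forall i, 0 <= g i)%E ->
  (\esum_(i in [set: I]) (d%:E * g i) <= d%:E * \esum_(i in [set: I]) g i)%E.
  move=> d0 g0. apply: esum_le_fset => F.
  rewrite -ge0_sume_distrr//; apply: lee_wpmul2l; first by rewrite lee_fin.
  apply: esum_ge; exists [set` F]; first by split.
  by rewrite fsbig_finite//= set_fsetK.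
rewrite le_eqVlt => /predU1P[<- _|c0 f0].
  by rewrite mul0e esum1// => i _; rewrite mul0e.
apply/eqP; rewrite eq_le (aux _ _ (ltW c0) f0)/=.
have h := @aux c^-1 (fun i => c%:E * f i)%E.
move: h; rewrite invr_ge0 ltW// => /(_ isT) h.
have {}h := h (fun i => mule_ge0 (ltW c0 : (0 <= c%:E)%E) (f0 i)).
rewrite (@eq_esum _ _ _ _ f) in h; last first.
  by move=> i _; rewrite muleA -EFinM mulVf ?mul1e// gt_eqF.
by rewrite -lee_pdivlMl.
Qed.

(** [g] and [h] may overlap, so a sum can be evaluated from any convenient splitting, such as inflow
    minus outflow, and not only from its positive and negative parts. *)
Lemma usum_decomp (I : choiceType) (f g h : I -> R) :
  (forall i, 0 <= g i) -> (forall i, 0 <= h i) -> (forall i, f i = g i - h i) ->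
  (\esum_(i in [set: I]) (g i)%:E < +oo)%E ->
  (\esum_(i in [set: I]) (h i)%:E < +oo)%E ->
  usum f = fine (\esum_(i in [set: I]) (g i)%:E) -
           fine (\esum_(i in [set: I]) (h i)%:E).
Proof.
move=> g0 h0 /funext-> gfin hfin.
have G0 : (0 <= \esum_(i in [set: I]) (g i)%:E)%E.
  by apply: esum_ge0 => i _; rewrite lee_fin.
have H0 : (0 <= \esum_(i in [set: I]) (h i)%:E)%E.
  by apply: esum_ge0 => i _; rewrite lee_fin.
have abs (k : I -> R) : (forall i, 0 <= k i) ->
    \esum_(i in [set: I]) `|(k i)%:E|%E = \esum_(i in [set: I]) (k i)%:E.
  by move=> k0; apply: eq_esum => i _; rewrite gee0_abs ?lee_fin.
rewrite /usum (_ : EFin \o _ = (EFin \o g) \- (EFin \o h))%E; last first.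
  by apply/funext => i /=; rewrite EFinB.
rewrite esumB; last first.
- by move=> i _; rewrite lee_fin.
- by move=> i _; rewrite lee_fin.
- by rewrite /summable abs.
- by rewrite /summable abs.
by rewrite fineB// ge0_fin_numE.
Qed.

Lemma usum_ge0E (I : choiceType) (f : I -> R) : (forall i, 0 <= f i) ->
  usum f = fine (\esum_(i in [set: I]) (f i)%:E).
Proof.
move=> f0; rewrite /usum [X in (_ - X)%E](_ : _ = 0%E) ?sube0.
  congr fine; apply: eq_esum => i _.
  by rewrite funeposE/= max_l// lee_fin.
by rewrite esum1// => i _; rewrite funenegE/= max_r// lee_fin oppr_le0.
Qed.

Definition abssum (I : choiceType) (f : I -> R) : Prop :=
  (\esum_(i in [set: I]) `|f i|%:E < +oo)%E.

Lemma le_abssum (I : choiceType) (f g : I -> R) :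
  (forall i, `|f i| <= g i) -> (\esum_(i in [set: I]) (g i)%:E < +oo)%E -> abssum f.
Proof. by move=> fg; apply: le_lt_trans; apply: le_esum => i _; rewrite lee_fin. Qed.

Lemma abssum_parts (I : choiceType) (f : I -> R) : abssum f ->
  [/\ (forall i, f i = Num.max (f i) 0 - Num.max (- f i) 0),
   (\esum_(i in [set: I]) (Num.max (f i) 0)%:E < +oo)%E &
   (\esum_(i in [set: I]) (Num.max (- f i) 0)%:E < +oo)%E].
Proof.
move=> af; split.
- move=> i; have [h|h] := leP 0 (f i).
    by rewrite max_r ?subr0// oppr_le0.
  by rewrite max_l ?sub0r ?opprK// oppr_ge0 ltW.
- apply: le_lt_trans af; apply: le_esum => i _.
  by rewrite lee_fin ge_max ler_norm normr_ge0.
- apply: le_lt_trans af; apply: le_esum => i _.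
  by rewrite lee_fin ge_max -normrN ler_norm normr_ge0.
Qed.

Lemma max0_ge0 (x : R) : 0 <= Num.max x 0.
Proof. by rewrite le_max lexx orbT. Qed.

Lemma abssum_usum (I : choiceType) (f : I -> R) : abssum f ->
  usum f = fine (\esum_(i in [set: I]) (Num.max (f i) 0)%:E) -
           fine (\esum_(i in [set: I]) (Num.max (- f i) 0)%:E).
Proof.
move=> /abssum_parts[e p n]; apply: usum_decomp => // i; exact: max0_ge0.
Qed.

Lemma esum_fin (I : choiceType) (f : I -> R) : (forall i, 0 <= f i) ->
  (\esum_(i in [set: I]) (f i)%:E < +oo)%E ->
  \esum_(i in [set: I]) (f i)%:E = (fine (\esum_(i in [set: I]) (f i)%:E))%:E.
Proof.
move=> f0 ff; rewrite fineK// ge0_fin_numE//.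
by apply: esum_ge0 => i _; rewrite lee_fin.
Qed.

Lemma esum_fin_num (I : choiceType) (f : I -> R) : (forall i, 0 <= f i) ->
  (\esum_(i in [set: I]) (f i)%:E < +oo)%E ->
  \esum_(i in [set: I]) (f i)%:E \is a fin_num.
Proof. by move=> f0 ff; rewrite esum_fin. Qed.

Lemma usumN (I : choiceType) (f : I -> R) : abssum f ->
  usum (fun i => - f i) = - usum f.
Proof.
move=> af; rewrite (abssum_usum af).
have [ef pf nf] := abssum_parts af.
rewrite (@usum_decomp _ _ (fun i => Num.max (- f i) 0) (fun i => Num.max (f i) 0))//.
- by rewrite opprB.
- by move=> i; exact: max0_ge0.
- by move=> i; exact: max0_ge0.
- by move=> i; rewrite {1}ef opprB.
Qed.

Lemma abssumZ (I : choiceType) (c : R) (f : I -> R) : abssum f ->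
  abssum (fun i => c * f i).
Proof.
move=> af; rewrite /abssum; under eq_esum do rewrite normrM EFinM.
by rewrite esumZ// lte_mul_pinfty// lee_fin.
Qed.

Lemma usumZ (I : choiceType) (c : R) (f : I -> R) : abssum f ->
  usum (fun i => c * f i) = c * usum f.
Proof.
have pos (d : R) : 0 <= d -> abssum f -> usum (fun i => d * f i) = d * usum f.
  move=> d0 af; rewrite (abssum_usum af); have [ef pf nf] := abssum_parts af.
  rewrite (@usum_decomp _ _ (fun i => d * Num.max (f i) 0)
            (fun i => d * Num.max (- f i) 0)).
  - under eq_esum do rewrite EFinM.
    rewrite esumZ//; last by move=> i; rewrite lee_fin max0_ge0.
    under [X in _ - fine X = _]eq_esum do rewrite EFinM.
    rewrite esumZ//; last by move=> i; rewrite lee_fin max0_ge0.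
    rewrite !fineM//; try by (apply: esum_fin_num => // i; exact: max0_ge0).
    by rewrite mulrBr.
  - by move=> i; rewrite mulr_ge0// max0_ge0.
  - by move=> i; rewrite mulr_ge0// max0_ge0.
  - by move=> i; rewrite {1}ef mulrBr.
  - under eq_esum do rewrite EFinM.
    rewrite esumZ//; last by move=> i; rewrite lee_fin max0_ge0.
    by rewrite lte_mul_pinfty// lee_fin.
  - under eq_esum do rewrite EFinM.
    rewrite esumZ//; last by move=> i; rewrite lee_fin max0_ge0.
    by rewrite lte_mul_pinfty// lee_fin.
move=> af; case: (leP 0 c) => [/pos->//|c0].
rewrite -[in RHS](opprK c) mulNr -pos ?oppr_ge0 ?ltW//.
rewrite -usumN; last exact: abssumZ.
by congr usum; apply/funext => i; rewrite mulNr opprK.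
Qed.

Lemma eq_usum (I : choiceType) (f g : I -> R) : f =1 g -> usum f = usum g.
Proof. by move=> /funext->. Qed.

Lemma usum_fset_support (I : choiceType) (f : I -> R) (F : {fset I}) :
  (forall i, i \notin F -> f i = 0) -> usum f = \sum_(i <- F) f i.
Proof.
move=> fF.
have pos (g : I -> R) : (forall i, 0 <= g i) -> (forall i, i \notin F -> g i = 0) ->
    \esum_(i in [set: I]) (g i)%:E = (\sum_(i <- F) g i)%:E.
  move=> g0 gF; rewrite (esum_fset_support (F := F)) ?sumEFin//.
  by move=> i /gF->.
have af : abssum f.
  by rewrite /abssum pos ?ltry// => i /fF->; rewrite normr0.
rewrite (abssum_usum af) !pos.
- rewrite -sumrB; apply: eq_bigr => i _; have [ef _ _] := abssum_parts af.
  by rewrite [RHS]ef.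
- by move=> i; exact: max0_ge0.
- by move=> i /fF->; rewrite oppr0 maxxx.
- by move=> i; exact: max0_ge0.
- by move=> i /fF->; rewrite maxxx.
Qed.

Lemma le_norm_usum (I : choiceType) (f g : I -> R) : (forall i, `|f i| <= g i) ->
  (\esum_(i in [set: I]) (g i)%:E < +oo)%E ->
  `|usum f| <= fine (\esum_(i in [set: I]) (g i)%:E).
Proof.
move=> fg gfin; have af : abssum f by exact: le_abssum gfin.
have [ef pf nf] := abssum_parts af.
have g0 i : 0 <= g i by apply: le_trans (fg i).
rewrite (abssum_usum af).
have h1 : fine (\esum_(i in [set: I]) (Num.max (f i) 0)%:E) <=
          fine (\esum_(i in [set: I]) (g i)%:E).
  rewrite -lee_fin -!esum_fin//; last by move=> i; exact: max0_ge0.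
  apply: le_esum => i _; rewrite lee_fin ge_max g0 andbT.
  by apply: le_trans (fg i); exact: ler_norm.
have h2 : fine (\esum_(i in [set: I]) (Num.max (- f i) 0)%:E) <=
          fine (\esum_(i in [set: I]) (g i)%:E).
  rewrite -lee_fin -!esum_fin//; last by move=> i; exact: max0_ge0.
  apply: le_esum => i _; rewrite lee_fin ge_max g0 andbT.
  by apply: le_trans (fg i); rewrite -normrN; exact: ler_norm.
have h3 : 0 <= fine (\esum_(i in [set: I]) (Num.max (f i) 0)%:E).
  by apply: fine_ge0; apply: esum_ge0 => i _; rewrite lee_fin max0_ge0.
have h4 : 0 <= fine (\esum_(i in [set: I]) (Num.max (- f i) 0)%:E).
  by apply: fine_ge0; apply: esum_ge0 => i _; rewrite lee_fin max0_ge0.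
rewrite ler_norml; apply/andP; split; lra.
Qed.

Lemma usum_exchange (I J : choiceType) (f : I -> J -> R) :
  (\esum_(i in [set: I]) \esum_(j in [set: J]) `|f i j|%:E < +oo)%E ->
  usum (fun i => usum (f i)) = usum (fun j => usum (f ^~ j)).
Proof.
have aux (I' J' : choiceType) (g : I' -> J' -> R) :
    (\esum_(i in [set: I']) \esum_(j in [set: J']) `|g i j|%:E < +oo)%E ->
    usum (fun i => usum (g i)) =
    fine (\esum_(i in [set: I']) \esum_(j in [set: J']) (Num.max (g i j) 0)%:E) -
    fine (\esum_(i in [set: I']) \esum_(j in [set: J']) (Num.max (- g i j) 0)%:E).
  move=> gfin.
  have rowfin i : abssum (g i).
    apply: le_lt_trans gfin; apply: (esum_ge1 (f := fun i => \esum_(j in [set: J']) `|g i j|%:E)).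
    by move=> k; apply: esum_ge0 => j _; rewrite lee_fin.
  have P0 i : (0 <= \esum_(j in [set: J']) (Num.max (g i j) 0)%:E)%E.
    by apply: esum_ge0 => j _; rewrite lee_fin max0_ge0.
  have N0 i : (0 <= \esum_(j in [set: J']) (Num.max (- g i j) 0)%:E)%E.
    by apply: esum_ge0 => j _; rewrite lee_fin max0_ge0.
  have PE : \esum_(i in [set: I']) \esum_(j in [set: J']) (Num.max (g i j) 0)%:E =
      \esum_(i in [set: I'])
        (fine (\esum_(j in [set: J']) (Num.max (g i j) 0)%:E))%:E.
    apply: eq_esum => i _; have [_ p _] := abssum_parts (rowfin i).
    by rewrite -esum_fin// => j; exact: max0_ge0.
  have NE : \esum_(i in [set: I']) \esum_(j in [set: J']) (Num.max (- g i j) 0)%:E =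
      \esum_(i in [set: I'])
        (fine (\esum_(j in [set: J']) (Num.max (- g i j) 0)%:E))%:E.
    apply: eq_esum => i _; have [_ _ p] := abssum_parts (rowfin i).
    by rewrite -esum_fin// => j; exact: max0_ge0.
  rewrite PE NE; apply: usum_decomp.
  - by move=> i; exact: fine_ge0.
  - by move=> i; exact: fine_ge0.
  - by move=> i; rewrite (abssum_usum (rowfin i)).
  - rewrite -PE; apply: le_lt_trans gfin; apply: le_esum => i _.
    by apply: le_esum => j _; rewrite lee_fin ge_max ler_norm normr_ge0.
  - rewrite -NE; apply: le_lt_trans gfin; apply: le_esum => i _.
    by apply: le_esum => j _; rewrite lee_fin ge_max -normrN ler_norm normr_ge0.
move=> ffin; rewrite aux// aux.
  by congr (fine _ - fine _); apply: esum_exchange => i j; rewrite lee_fin max0_ge0.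
by rewrite esum_exchange// => j i; rewrite lee_fin.
Qed.

(** The differences [g i - f i] are nonnegative and, since the sum of [f] is finite, they sum to
    zero. *)
Lemma esum_ge0_eq (I : choiceType) (f g : I -> R) :
  (forall i, 0 <= f i) -> (forall i, f i <= g i) ->
  (\esum_(i in [set: I]) (f i)%:E < +oo)%E ->
  \esum_(i in [set: I]) (g i)%:E = \esum_(i in [set: I]) (f i)%:E -> f =1 g.
Proof.
move=> f0 fg ffin e i; apply/eqP; rewrite eq_le fg/=.
have d0 j : (0 <= (g j - f j)%:E)%E by rewrite lee_fin subr_ge0.
have : \esum_(i in [set: I]) ((f i)%:E + (g i - f i)%:E)%E =
       \esum_(i in [set: I]) (f i)%:E.
  by rewrite -e; apply: eq_esum => j _; rewrite -EFinD addrC subrK.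
rewrite esumD//; last by move=> j _; rewrite lee_fin.
rewrite (esum_fin f0 ffin).
have := esum_ge1 i d0.
case: (\esum_(k in [set: I]) (g k - f k)%:E)%E => [r| |]//=.
  by rewrite lee_fin => h [] h2; lra.
Qed.

End UnorderedSums.

(** * Exponential series and matrix powers *)

Section ExponentialSeries.
Context {R : realType}.

(** Exponential generating function of [c]. With [c n = matpow A n i j] it is convertible to
    [matexp t A i j], which reduces matrix exponentials to scalar series. *)
Definition exps (c : R^nat) (t : R) : R := limn (series (fun n => exp_coeff t n * c n)).

Lemma is_cvg_exps (c : R^nat) (M b t : R) : (forall n, `|c n| <= M * b ^+ n) ->
  cvgn (series (fun n => exp_coeff t n * c n)).
Proof.
move=> cb; apply: normed_cvg.
have key n : `|exp_coeff t n * c n| <= (M *: exp_coeff (`|t| * b)) n.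
  rewrite /GRing.scale/= normrM /exp_coeff/= normrM normrX.
  rewrite (ger0_norm (x := _^-1))// exprMn.
  apply: le_trans (_ : `|t| ^+ n / n`!%:R * (M * b ^+ n) <= _).
    by rewrite ler_wpM2l// mulr_ge0// exprn_ge0.
  by rewrite le_eqVlt; apply/orP; left; apply/eqP; rewrite /GRing.scale/=; ring.
apply: (series_le_cvg (v_ := (M *: exp_coeff (`|t| * b)))) => //.
- by move=> n; exact: normr_ge0.
- by move=> n; exact: le_trans (normr_ge0 _) (key n).
- by apply: is_cvg_seriesZ; exact: is_cvg_series_exp_coeff.
Qed.

Lemma exps0 (c : R^nat) : exps c 0 = c 0%N.
Proof.
apply/cvg_lim => //; rewrite -(cvg_shiftS (series _)).
rewrite [X in X @ \oo --> _](_ : _ = cst (c 0%N)); first exact: cvg_cst.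
apply/funext => n; rewrite /series/= big_nat_recl//= big1 ?addr0.
  by rewrite /exp_coeff/= fact0 expr0 divr1 mul1r.
by move=> i _; rewrite /exp_coeff/= expr0n/= !mul0r.
Qed.

Lemma eq_exps (c d : R^nat) : c =1 d -> exps c = exps d.
Proof. by move=> /funext->. Qed.

Lemma expsZ (k : R) (c : R^nat) (M b t : R) : (forall n, `|c n| <= M * b ^+ n) ->
  exps (fun n => k * c n) t = k * exps c t.
Proof.
move=> cb; apply/cvg_lim => //.
rewrite (_ : series _ = (fun n => k * series (fun n => exp_coeff t n * c n) n)).
  by apply: cvgMr; exact: is_cvg_exps cb.
apply/funext => n; rewrite /series/= mulr_sumr; apply: eq_bigr => i _; ring.
Qed.

Lemma cvg_sumr (T : Type) (F : set_system T) (FF : Filter F) (I : Type) (s : seq I)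
    (f : I -> T -> R) (l : I -> R) : (forall i, f i x @[x --> F] --> l i) ->
  \sum_(i <- s) f i x @[x --> F] --> \sum_(i <- s) l i.
Proof. by move=> fl; apply: cvg_big => //; exact: add_continuous. Qed.

Lemma exps_sum (I : Type) (s : seq I) (k : I -> R) (c : I -> R^nat)
    (M b : I -> R) t :
  (forall i n, `|c i n| <= M i * b i ^+ n) ->
  exps (fun n => \sum_(i <- s) k i * c i n) t = \sum_(i <- s) k i * exps (c i) t.
Proof.
move=> cb; apply/cvg_lim => //.
rewrite (_ : series _ =
    (fun n => \sum_(i <- s) k i * series (fun n => exp_coeff t n * c i n) n)).
  apply: cvg_sumr => i; apply: cvgMr; exact: is_cvg_exps (cb i).
apply/funext => n; rewrite /series/=.
under [RHS]eq_bigr do rewrite mulr_sumr.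
rewrite exchange_big/=; apply: eq_bigr => j _; rewrite mulr_sumr.
by apply: eq_bigr => i _; ring.
Qed.

Lemma is_derive_exps (c : R^nat) (M b t : R) : (forall n, `|c n| <= M * b ^+ n) ->
  is_derive t 1 (exps c) (exps (fun n => c n.+1) t).
Proof.
move=> cb.
pose d n := c n / n`!%:R.
have serE (e : R^nat) x : pseries (fun n => e n / n`!%:R) x =
    series (fun n => exp_coeff x n * e n).
  by congr series; apply/funext => n; rewrite /exp_coeff/=; ring.
have diffE (e : R^nat) : pseries_diffs (fun n => e n / n`!%:R) =
    fun n => e n.+1 / n`!%:R.
  apply/funext => n; rewrite /pseries_diffs factS natrM invfM.
  by rewrite mulrCA mulrA -[LHS]mulrA mulVKf// pnatr_eq0.
have cb1 n : `|c n.+1| <= (M * b) * b ^+ n by rewrite -mulrA -exprS.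
have cb2 n : `|c n.+2| <= (M * b ^+ 2) * b ^+ n by rewrite -mulrA -exprD.
(* Termwise differentiation asks for convergence of the series and of its first two formal
   derivatives at a point of modulus greater than that of [t]. *)
have Kt : `|t| < `| `|t| + 1|.
  by rewrite [ltRHS]ger0_norm ?ltrDl// addr_ge0.
have := @pseries_snd_diffs R d (`|t| + 1) t.
rewrite !diffE !serE => /(_ (is_cvg_exps cb) (is_cvg_exps cb1) (is_cvg_exps cb2) Kt).
by rewrite (_ : (fun x => limn _) = exps c)//; apply/funext => x; rewrite serE.
Qed.

Lemma is_derive_sumr (I : Type) (s : seq I) (f : I -> R -> R) (df : I -> R) (x : R) :
  (forall i, is_derive x 1 (f i) (df i)) ->
  is_derive x 1 (fun y => \sum_(i <- s) f i y) (\sum_(i <- s) df i).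
Proof.
move=> fd; elim: s => [|i s IH].
  rewrite big_nil (_ : (fun y => _) = cst 0); first exact: is_derive_cst.
  by apply/funext => y; rewrite big_nil.
rewrite big_cons (_ : (fun y => _) = f i + (fun y => \sum_(i <- s) f i y)).
  exact: is_deriveD.
by apply/funext => y; rewrite big_cons.
Qed.

Lemma derivative_cvg_at_right (f : R -> R) (d : R) : is_derive (0 : R) 1 f d ->
  forall e, 0 < e -> \forall h \near (0 : R)^'+, `|(f h - f 0) / h - d| < e.
Proof.
move=> [fd <-] e e0; have /cvgrPdist_lt/(_ e e0) := fd.
move=> [r r0 H]; exists r => //= h hr h0; rewrite distrC.
have := H h hr; rewrite gt_eqF// => /(_ isT) /=.
by rewrite /GRing.scale/= mulr1 addr0 mulrC.
Qed.

End ExponentialSeries.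

Section MatrixPowers.
Context {R : realType} {Omega : choiceType}.
Variables (A : Omega -> Omega -> R) (a : R).
Hypothesis row_le : forall i, (\esum_(j in [set: Omega]) `|A i j|%:E <= a%:E)%E.

Let row_fin i : (\esum_(j in [set: Omega]) `|A i j|%:E < +oo)%E.
Proof. exact: le_lt_trans (row_le i) (ltry _). Qed.

(** A state is required because [row_le] says nothing about [a] when [Omega] is empty. *)
Let a0 : Omega -> 0 <= a.
Proof.
by move=> i; rewrite -lee_fin; apply: le_trans (row_le i); apply: esum_ge0 => j _; rewrite lee_fin.
Qed.

Lemma matpowS n i j : matpow A n.+1 i j = usum (fun k => A i k * matpow A n k j).
Proof. by []. Qed.

Lemma abssum_rowM (f : Omega -> R) (M : R) i : 0 <= M -> (forall k, `|f k| <= M) ->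
  (\esum_(k in [set: Omega]) (`|A i k| * M)%:E <= (a * M)%:E)%E /\
  abssum (fun k => A i k * f k).
Proof.
move=> M0 fM.
have h : (\esum_(k in [set: Omega]) (`|A i k| * M)%:E <= (a * M)%:E)%E.
  under eq_esum do rewrite mulrC EFinM.
  rewrite esumZ//.
  by rewrite [leRHS](_ : _ = M%:E * a%:E)%E ?lee_wpmul2l ?lee_fin// -EFinM mulrC.
split => //; apply: (le_abssum (g := fun k => `|A i k| * M)).
  by move=> k; rewrite normrM ler_wpM2l.
exact: le_lt_trans h (ltry _).
Qed.

Lemma matpow_bound n i j : `|matpow A n i j| <= a ^+ n.
Proof.
elim: n i j => [|n IH] i j.
  by rewrite /matpow/= /matid expr0; case: (i == j); rewrite ?normr1 ?normr0.
have M0 : 0 <= a ^+ n by rewrite exprn_ge0// (a0 i).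
have [h1 h2] := abssum_rowM i M0 (fun k => IH k j).
rewrite matpowS exprS.
apply: le_trans (_ : fine (\esum_(k in [set: Omega]) (`|A i k| * a ^+ n)%:E) <= _).
  apply: le_norm_usum; last exact: le_lt_trans h1 (ltry _).
  by move=> k; rewrite normrM ler_wpM2l.
rewrite -lee_fin -esum_fin//; last exact: le_lt_trans h1 (ltry _).
by move=> k; rewrite mulr_ge0.
Qed.

Lemma matpow_bound1 i j n : `|matpow A n i j| <= 1 * a ^+ n.
Proof. by rewrite mul1r matpow_bound. Qed.

Hypothesis col_fin : forall j, (\esum_(i in [set: Omega]) `|A i j|%:E < +oo)%E.

(** [matpow] multiplies on the left. Moving the new factor to the right is associativity of infinite
    products, an exchange of sums justified by the row bound on one side and the column sums on the
    other. *)
Lemma matpowSr n i j : matpow A n.+1 i j = usum (fun k => matpow A n i k * A k j).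
Proof.
have l1 k l : usum (fun m => (matid k m : R) * A m l) = A k l.
  rewrite (usum_fset_support (F := [fset k]%fset)).
    by rewrite big_seq_fset1 /matid eqxx mul1r.
  by move=> m; rewrite inE /matid eq_sym => /negPf->; rewrite mul0r.
elim: n i j => [|n IH] i j.
  rewrite l1 matpowS /matpow/= (usum_fset_support (F := [fset j]%fset)).
    by rewrite big_seq_fset1 /matid eqxx mulr1.
  by move=> m; rewrite inE /matid => /negPf->; rewrite mulr0.
have M0 : 0 <= a ^+ n by rewrite exprn_ge0// (a0 i).
have colM l : abssum (fun k => matpow A n l k * A k j).
  apply: (le_abssum (g := fun k => a ^+ n * `|A k j|)).
    by move=> k; rewrite normrM ler_wpM2r// matpow_bound.
  under eq_esum do rewrite EFinM.
  by rewrite esumZ ?lte_mul_pinfty// ?lee_fin// => k; rewrite lee_fin.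
transitivity (usum (fun l => usum (fun k => A i l * (matpow A n l k * A k j)))).
  rewrite matpowS; apply: eq_usum => l; rewrite IH usumZ//.
rewrite usum_exchange.
  apply: eq_usum => k; rewrite matpowS mulrC -usumZ.
    by apply: eq_usum => l; ring.
  by have [] := abssum_rowM i M0 (fun l => matpow_bound n l k).
apply: (@le_lt_trans _ _ (\esum_(l in [set: Omega]) \esum_(k in [set: Omega])
    (`|A i l| * a ^+ n * `|A k j|)%:E)).
  apply: le_esum => l _; apply: le_esum => k _; rewrite lee_fin !normrM.
  by rewrite -mulrA ler_wpM2l// ler_wpM2r// matpow_bound.
under eq_esum => l _.
  under eq_esum => k _ do rewrite EFinM.
  rewrite esumZ; [|by rewrite mulr_ge0|by move=> k; rewrite lee_fin].
  rewrite [X in (_ * X)%E]esum_fin// -EFinM mulrAC EFinM muleC.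
  over.
have c0 : 0 <= fine (\esum_(k in [set: Omega]) `|A k j|%:E).
  by apply: fine_ge0; apply: esum_ge0 => k _; rewrite lee_fin.
rewrite esumZ//; last by move=> k; rewrite lee_fin mulr_ge0.
apply: lte_mul_pinfty; rewrite ?lee_fin//.
under eq_esum do rewrite mulrC EFinM.
by rewrite esumZ// lte_mul_pinfty// lee_fin.
Qed.

(** Transposition with weights [X] reverses products, so the induction expands one side on the left
    and the other on the right. *)
Lemma matpow_reversible (X : Omega -> R) :
  (forall i j, X j * A i j = X i * A j i) ->
  forall n i j, X j * matpow A n i j = X i * matpow A n j i.
Proof.
move=> XA; elim=> [|n IH] i j.
  by rewrite /matpow/= /matid eq_sym; case: eqP => [->|]; rewrite ?mulr0.
have M0 : 0 <= a ^+ n by rewrite exprn_ge0// (a0 i).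
rewrite matpowS matpowSr -!usumZ.
- by apply: eq_usum => k; rewrite mulrCA IH mulrCA mulrA XA; ring.
- apply: (le_abssum (g := fun k => a ^+ n * `|A k i|)).
    by move=> k; rewrite normrM ler_wpM2r// matpow_bound.
  under eq_esum do rewrite EFinM.
  by rewrite esumZ ?lte_mul_pinfty// ?lee_fin// => k; rewrite lee_fin.
- by have [] := abssum_rowM i M0 (fun l => matpow_bound n l j).
Qed.

Lemma matexp_reversible (X : Omega -> R) :
  (forall i j, X j * A i j = X i * A j i) ->
  forall t i j, X j * matexp t A i j = X i * matexp t A j i.
Proof.
move=> XA t i j.
have h := matpow_reversible XA.
rewrite -[matexp t A i j]/(exps (fun n => matpow A n i j) t).
rewrite -[matexp t A j i]/(exps (fun n => matpow A n j i) t).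
rewrite -(expsZ _ _ (matpow_bound1 i j)) -(expsZ _ _ (matpow_bound1 j i)).
by congr exps; apply/funext => n; rewrite h.
Qed.

End MatrixPowers.

(** * Renewal at a state *)

Section RenewalAlgebra.
Context {R : realType}.
Implicit Types (p a b : nat -> R).

(* [avoid_prob p g n]: probability that a renewal process with renewal
   probabilities [p], last seen to renew [g] steps ago, does not renew during
   the next [n] steps. *)
Fixpoint avoid_prob p (g n : nat) : R :=
  if n is m.+1 then avoid_prob p g.+1 m - p g.+1 * avoid_prob p 0 m else 1.

(** Decomposition by the last renewal in the window, at step [k.+1]. The age [g] must be general, as
    the recursion changes it. *)
Lemma avoid_prob_sum p g n :
  avoid_prob p g n + \sum_(k < n) p (g + k.+1)%N * avoid_prob p 0 (n - k.+1) = 1.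
Proof.
elim: n g => [|n IH] g; first by rewrite big_ord0 addr0.
rewrite big_ord_recl/= -[in RHS](IH g.+1) addn1 subn1/= -addrA; congr (_ + _).
rewrite addKr; apply: eq_bigr => k _.
by rewrite /bump/= add1n addSnnS subSS.
Qed.

Lemma sum_convolution a b M :
  \sum_(N < M) \sum_(k < N.+1) a k * b (N - k)%N =
  \sum_(k < M) a k * \sum_(n < M - k) b n.
Proof.
elim: M => [|M IH]; first by rewrite !big_ord0.
rewrite big_ord_recr/= IH [RHS]big_ord_recr/= subSnn big_ord1.
rewrite [X in _ + X]big_ord_recr/= subnn addrA -big_split/=; congr (_ + _).
apply: eq_bigr => k _; rewrite subSn; last exact: ltnW.
by rewrite big_ord_recr/= mulrDr.
Qed.

Lemma sum_ord_widen b n m : (forall k, 0 <= b k) -> (n <= m)%N ->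
  \sum_(k < n) b k <= \sum_(k < m) b k.
Proof.
move=> b0 /subnKC <-; elim: (m - n)%N => [|d IH]; first by rewrite addn0.
by rewrite addnS big_ord_recr/=; apply: le_trans IH _; rewrite lerDl.
Qed.

(** The last-renewal identity is summed over all horizons below [M], and each inner sum of avoidance
    probabilities is enlarged to [M] terms. *)
Lemma renewal_cesaro p M : p 0%N = 1 -> (forall k, 0 <= p k) ->
  (forall n, 0 <= avoid_prob p 0 n) ->
  M%:R <= (\sum_(k < M) p k) * (\sum_(n < M) avoid_prob p 0 n).
Proof.
move=> p0 pge v0.
have -> : M%:R = \sum_(N < M) \sum_(k < N.+1) p k * avoid_prob p 0 (N - k).
  rewrite (eq_bigr (fun=> 1)) ?sumr_const ?card_ord// => N _.
  rewrite big_ord_recl/= p0 mul1r subn0 -[RHS](avoid_prob_sum p 0 N).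
  by congr (_ + _); apply: eq_bigr => k _; rewrite add0n.
rewrite sum_convolution mulr_suml; apply: ler_sum => k _.
by apply: ler_wpM2l => //; apply: sum_ord_widen; rewrite // leq_subr.
Qed.

(** Here [p 1 ^+ k] is the probability of a first sojourn of [k] steps and [r N] bounds from above
    that of no return by step [N]. Summing over [N], the [L] delays of weight at least 1/2 give
    [L / 2] times the sum of avoidance probabilities, while monotonicity lets [r] be sampled once
    per block of [L] steps. The factor [L] cancels, so the bound survives refinement of the grid. *)
Lemma avoid_prob_sum_le p (r : nat -> R) (L m : nat) :
  (forall n, 0 <= avoid_prob p 0 n) -> 0 <= p 1%N ->
  (forall k, (k < L)%N -> 2^-1 <= p 1%N ^+ k) ->
  (forall N, \sum_(k < N.+1) p 1%N ^+ k * avoid_prob p 0 (N - k) <= r N) ->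
  (forall N N', (N <= N')%N -> r N' <= r N) ->
  (0 < L)%N ->
  \sum_(n < m * L) avoid_prob p 0 n <= 2 * \sum_(i < m.+1) r (i * L)%N.
Proof.
move=> v0 p1 pL rN rmono L0.
have L0' : (0 : R) < L%:R by rewrite ltr0n.
(* The horizon has one block more than [m], since a delay of [k < L] steps must leave room for
   [m * L] steps. *)
have h1 : L%:R * 2^-1 * \sum_(n < m * L) avoid_prob p 0 n <=
    \sum_(N < m.+1 * L) r N.
  apply: le_trans (ler_sum _ (fun (N : 'I_(m.+1 * L)) _ => rN N)).
  rewrite (sum_convolution (fun k => p 1%N ^+ k)).
  apply: (@le_trans _ _ (\sum_(k < L) p 1%N ^+ k *
      \sum_(n < m.+1 * L - k) avoid_prob p 0 n)); last first.
    apply: (sum_ord_widen (b := fun k => p 1%N ^+ k *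
      \sum_(n < m.+1 * L - k) avoid_prob p 0 n)); last by rewrite mulSn leq_addr.
    by move=> k; rewrite mulr_ge0 ?exprn_ge0// sumr_ge0.
  rewrite -[leLHS]mulrA mulr_natl -[X in _ *+ X]card_ord -sumr_const.
  apply: ler_sum => k _; apply: ler_pM => //; rewrite ?invr_ge0 ?sumr_ge0 ?pL//.
  by apply: sum_ord_widen => //; rewrite mulSn addnC -addnBA ?leq_addr// ltnW.
have h2 M : \sum_(N < M * L) r N <= L%:R * \sum_(i < M) r (i * L)%N.
  elim: M => [|M IH]; first by rewrite mul0n !big_ord0 mulr0.
  rewrite [in leRHS]big_ord_recr/= mulrDr mulSn addnC big_split_ord/= lerD//.
  rewrite mulr_natl -[X in _ *+ X]card_ord -sumr_const; apply: ler_sum => i _.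
  by apply: rmono; rewrite leq_addr.
have := le_trans h1 (h2 _).
by rewrite -mulrA ler_pM2l// mulrC ler_pdivrMr// mulrC.
Qed.

Lemma bernoulli_ge (x : R) k : 0 <= x <= 1 -> 1 - k%:R * x <= (1 - x) ^+ k.
Proof.
move=> /andP[x0 x1]; elim: k => [|k IH]; first by rewrite mul0r subr0 expr0.
rewrite exprS; apply: le_trans (ler_wpM2l _ IH); last lra.
have := ler0n R k; rewrite -natr1; nra.
Qed.

End RenewalAlgebra.

(** * A layer cake bound for integrals *)

Section LayerCake.
Import HBNNSimple.
Context {R : realType} {d : measure_display} {T : measurableType d}.
Variable mu : {measure set T -> \bar R}.

(** At [x] the layer sum is at most [i * delta] for the last layer [D i] containing [x], hence at
    most [f x]. The layer sum is a simple function and the integral of [f] a supremum over simple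
    functions below it, so the bound applies to the return time without a study of its
    measurability. *)
Lemma sum_measure_le_integral (D : nat -> set T) (f : T -> \bar R) (delta : R) n :
  0 <= delta -> (forall i, measurable (D i)) -> (forall x, 0 <= f x)%E ->
  (forall i x, D i x -> ((i%:R * delta)%:E <= f x)%E) ->
  (\sum_(i < n) delta%:E * mu (D i.+1) <= \int[mu]_x f x)%E.
Proof.
move=> d0 mD f0 Df.
pose g i := scale_nnsfun (indic_nnsfun R (mD i.+1)) d0.
have gE i x : g i x = delta * \1_(D i.+1) x by [].
rewrite [leRHS]ge0_integralTE//.
apply: (@le_trans _ _ (sintegral mu (sum_nnsfun g n))); last first.
  apply: ereal_sup_ubound; exists (sum_nnsfun g n) => //= x.
  rewrite sum_nnsfunE.
  elim: n => [|n IH]; first by rewrite big_ord0.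
  have h' m : (\sum_(i < m) g i x) <= m%:R * delta.
    rewrite mulr_natl -[X in _ *+ X]card_ord -sumr_const; apply: ler_sum => i _.
    by rewrite gE indicE; case: (x \in _); rewrite ?mulr1 ?mulr0.
  have [xD|xD] := pselect (D n.+1 x).
    by apply: le_trans (Df _ _ xD); rewrite lee_fin.
  have gn : g n x = 0 by rewrite gE indicE memNset// mulr0.
  have -> : \sum_(i < n.+1) g i x = \sum_(i < n) g i x + g n x.
    by rewrite big_ord_recr.
  by rewrite gn addr0.
rewrite -integralT_nnsfun.
under eq_integral do rewrite sum_nnsfunE -sumEFin.
rewrite ge0_integral_sum//.
- apply: lee_sum => i _.
  under eq_integral do rewrite gE EFinM.
  rewrite ge0_integralZl_EFin//.
  + by rewrite integral_indic// setIT.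
  + by apply/measurable_EFinP; exact: measurable_indic.
- by move=> i; apply/measurable_EFinP.
- by move=> i x _; rewrite lee_fin gE mulr_ge0// indicE.
Qed.

End LayerCake.

(** * Visits of the chain to its initial state on a grid *)

Section Renewal.
Context {R : realType} {Omega : choiceType}.
Variables (A : Omega -> Omega -> R) (o : Omega).
Context {d : measure_display} {T : measurableType d}.
Variables (P : probability T R) (X : R -> T -> Omega).
Hypothesis HM : markov_chain A o P X.

Definition pr (B : set T) : R := fine (P B).

Lemma prE B : measurable B -> P B = (pr B)%:E.
Proof. by move=> mB; rewrite /pr fineK// fin_num_measure. Qed.

Lemma pr_ge0 B : 0 <= pr B.
Proof. exact: fine_ge0. Qed.

Lemma le_pr B C : measurable B -> measurable C -> B `<=` C -> pr B <= pr C.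
Proof.
move=> mB mC BC; rewrite -lee_fin -!prE//.
by apply: le_measure => //; rewrite inE.
Qed.

Lemma pr_split B C : measurable B -> measurable C ->
  pr B = pr (B `&` C) + pr (B `&` ~` C).
Proof.
move=> mB mC; apply: EFin_inj; rewrite EFinD -!prE//.
- rewrite -measureU ?setIUr//.
  + by rewrite -setIUr setUv setIT.
  + exact: measurableI.
  + by apply: measurableI => //; exact: measurableC.
  + by rewrite setIACA setICr setI0.
- by apply: measurableI => //; exact: measurableC.
- exact: measurableI.
Qed.

Definition past (us : seq (R * Omega)) : set T :=
  [set w | forall u, u \in us -> X u.1 w = u.2].

Lemma measurable_state t i : 0 <= t -> measurable (X t @^-1` [set i]).
Proof. by case: HM => mX _ _ _; exact: mX. Qed.

Lemma past_cons u us : past (u :: us) = X u.1 @^-1` [set u.2] `&` past us.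
Proof.
apply/seteqP; split => w /=.
  move=> H; split; first by apply: H; rewrite mem_head.
  by move=> v vus; apply: H; rewrite inE vus orbT.
by move=> [wu wus] v; rewrite inE => /predU1P[->//|]; exact: wus.
Qed.

Lemma measurable_past us : (forall u, u \in us -> 0 <= u.1) -> measurable (past us).
Proof.
elim: us => [|u us IH] us0.
  by rewrite (_ : past _ = setT)//; apply/seteqP; split.
rewrite past_cons; apply: measurableI.
  by apply: measurable_state; apply: us0; rewrite mem_head.
by apply: IH => v vus; apply: us0; rewrite inE vus orbT.
Qed.

Lemma markov_past s t i j us : 0 <= s -> 0 <= t ->
  (forall u, u \in us -> 0 <= u.1 <= s) ->
  pr (X (s + t) @^-1` [set i] `&` past ((s, j) :: us)) =
  matexp t A i j * pr (past ((s, j) :: us)).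
Proof.
move=> s0 t0 us0; case: HM => _ _ _ /(_ s t i j us s0 t0 us0) /= H.
have mp : measurable (past ((s, j) :: us)).
  apply: measurable_past => u; rewrite inE => /predU1P[->//|].
  by move=> /us0 /andP[].
apply: EFin_inj; rewrite EFinM -!prE//.
  by rewrite past_cons.
by apply: measurableI => //; apply: measurable_state; exact: addr_ge0.
Qed.

Lemma pr_start : pr (X 0 @^-1` [set o]) = 1.
Proof. by case: HM => _ _ H _; rewrite /pr H. Qed.

Lemma prI_start B : measurable B -> pr (B `&` X 0 @^-1` [set o]) = pr B.
Proof.
move=> mB; have m0 : measurable (X 0 @^-1` [set o]) by exact: measurable_state.
rewrite [RHS](pr_split mB m0) [X in _ + X](_ : _ = 0) ?addr0//.
apply/eqP; rewrite eq_le pr_ge0 andbT.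
have mC := measurableC m0.
apply: (@le_trans _ _ (pr (~` (X 0 @^-1` [set o])))).
  by apply: le_pr => //; first [exact: subIsetr|exact: measurableI].
have := pr_split measurableT m0; rewrite !setTI pr_start.
by rewrite /pr probability_setT/= => h; lra.
Qed.

Lemma transition_prob t i : 0 <= t -> pr (X t @^-1` [set i]) = matexp t A i o.
Proof.
move=> t0.
have := @markov_past 0 t i o [::] (lexx _) t0 (fun u => ltac:(by [])).
have mt := measurable_state i t0; have m0 := measurable_state o (lexx (0 : R)).
rewrite add0r past_cons (_ : past [::] = setT); last by apply/seteqP; split.
by rewrite setIT /= prI_start// pr_start mulr1.
Qed.

Section Grid.
Variable h : R.
Hypothesis h0 : 0 < h.

Let at_o j : set T := X (j%:R * h) @^-1` [set o].
Let hist (J : seq nat) : set T := past [seq (j%:R * h, o) | j <- J].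
Let avoid (s n : nat) : set T :=
  [set w | forall j, (s < j <= s + n)%N -> X (j%:R * h) w <> o].
Let p (n : nat) : R := matexp (n%:R * h) A o o.

Let jh_ge0 j : 0 <= j%:R * h :> R.
Proof. by rewrite mulr_ge0// ltW. Qed.

Let m_at j : measurable (at_o j).
Proof. exact: measurable_state. Qed.

Let m_hist J : measurable (hist J).
Proof. by apply: measurable_past => u /mapP[j _ ->]/=. Qed.

Let avoidS s n : avoid s n.+1 = ~` at_o s.+1 `&` avoid s.+1 n.
Proof.
apply/seteqP; split => w /=.
  move=> H; split; first by apply: H; lia.
  by move=> j hj; apply: H; lia.
move=> [H1 H2] j hj; have [->//|hne] := eqVneq j s.+1; apply: H2; lia.
Qed.

Let avoid0 s : avoid s 0 = setT.
Proof. by apply/seteqP; split => w //= _ j; lia. Qed.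

Let m_avoid s n : measurable (avoid s n).
Proof.
elim: n s => [|n IH] s; first by rewrite avoid0.
by rewrite avoidS; apply: measurableI => //; exact: measurableC.
Qed.

(** Splitting according to the state at step [s + g + 1] reproduces the recursion of [avoid_prob]:
    ignoring that step raises the age, and a visit there becomes the new present with age 0. Only
    visits to [o] enter the history, so the Markov property always applies at [o]. *)
Lemma pr_avoid n s g J : (forall j, j \in J -> (j <= s)%N) ->
  pr (hist (s :: J) `&` avoid (s + g) n) = avoid_prob p g n * pr (hist (s :: J)).
Proof.
elim: n s g J => [|n IH] s g J Js /=; first by rewrite avoid0 setIT mul1r.
have mh := m_hist (s :: J).
have e1 := pr_split (measurableI _ _ mh (m_avoid (s + g).+1 n)) (m_at (s + g).+1).
have e2 : hist (s :: J) `&` avoid (s + g) n.+1 =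
    hist (s :: J) `&` avoid (s + g).+1 n `&` ~` at_o (s + g).+1.
  by rewrite avoidS -setIA [in RHS](setIC (avoid _ _)).
have e3 : hist (s :: J) `&` avoid (s + g).+1 n `&` at_o (s + g).+1 =
    hist ((s + g).+1 :: s :: J) `&` avoid ((s + g).+1 + 0) n.
  by rewrite addn0 setIAC [in RHS]/hist/= [in RHS]past_cons (setIC (hist _)).
have IH1 := IH s g.+1 J Js; rewrite addnS in IH1.
have Js' j : j \in s :: J -> (j <= (s + g).+1)%N.
  by rewrite inE => /predU1P[->|/Js]; lia.
have IH2 := IH (s + g).+1 0%N (s :: J) Js'.
have e4 : pr (hist ((s + g).+1 :: s :: J)) = p g.+1 * pr (hist (s :: J)).
  rewrite /hist/= past_cons/= -markov_past//.
  - by rewrite -mulrDl -natrD addnS.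
  - move=> u /mapP[j jJ ->]/=; rewrite jh_ge0/= ler_pM2r// ler_nat; exact: Js.
move: e1; rewrite e2 e3 IH1 IH2 e4 => e1; lra.
Qed.

Let v n := avoid_prob p 0 n.

Let p0 : p 0%N = 1.
Proof. by rewrite /p -transition_prob// mul0r pr_start. Qed.

Let p_ge0 k : 0 <= p k.
Proof. by rewrite /p -transition_prob// pr_ge0. Qed.

Let hist1 : pr (hist [:: 0%N]) = 1.
Proof.
rewrite /hist/= past_cons/= mul0r (_ : past [::] = setT) ?setIT ?pr_start//.
by apply/seteqP; split.
Qed.

Lemma avoid_prob_ge0 n : 0 <= v n.
Proof.
have := @pr_avoid n 0%N 0%N [::] (fun u => ltac:(by [])).
by rewrite hist1 mulr1 /v => <-; exact: pr_ge0.
Qed.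

(** The grid visits to [o] up to step [N] form an initial segment. *)
Definition no_return (N : nat) : set T :=
  [set w | forall a b, (a < b <= N)%N -> X (b%:R * h) w = o -> X (a%:R * h) w = o].

Lemma measurable_no_return N : measurable (no_return N).
Proof.
rewrite (_ : no_return N = \bigcap_a \bigcap_b
    (if (a < b <= N)%N then ~` at_o b `|` at_o a else setT)).
  apply: bigcapT_measurable => a; apply: bigcapT_measurable => b.
  by case: ifP => // _; apply: measurableU => //; exact: measurableC.
apply/seteqP; split => w /=.
  move=> H a _ b _; case: ifP => //= hab.
  by have [/H h1|] := pselect (X (b%:R * h) w = o); [right; exact: h1|left].
by move=> H a b hab; have := H a I b I; rewrite hab /= => -[].
Qed.

(** The events of staying at [o] during steps 0 to [k] and avoiding it from [k + 1] to [N] are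
    disjoint and exclude a return; the Markov property factors their probabilities. *)
Lemma pr_no_return_ge N :
  \sum_(k < N.+1) p 1%N ^+ k * v (N - k)%N <= pr (no_return N).
Proof.
pose E k := hist (k :: rev (iota 0 k)) `&` avoid (k + 0) (N - k).
have iotaS k : rev (iota 0 k.+1) = k :: rev (iota 0 k).
  by rewrite -addn1 iotaD rev_cat.
have E1 k : pr (hist (k :: rev (iota 0 k))) = p 1%N ^+ k.
  elim: k => [|k IH]; first by rewrite hist1.
  rewrite iotaS exprS -IH /hist/= past_cons/= -markov_past//.
  + by rewrite -mulrDl -natr1.
  + move=> u /mapP[j]; rewrite mem_rev mem_iota => jk ->/=.
    by rewrite jh_ge0/= ler_pM2r// ler_nat; lia.
have E2 k : pr (E k) = p 1%N ^+ k * v (N - k)%N.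
  rewrite /E pr_avoid ?E1 1?mulrC// => j; rewrite mem_rev mem_iota; lia.
have mE k : measurable (E k) by exact: measurableI.
have histE k w : hist (k :: rev (iota 0 k)) w <->
    forall j, (j <= k)%N -> X (j%:R * h) w = o.
  split => [H j jk|H u /mapP[j hj ->]].
    apply: (H (j%:R * h, o)); apply/mapP; exists j => //.
    by rewrite inE mem_rev mem_iota; lia.
  by apply: H; move: hj; rewrite inE mem_rev mem_iota; lia.
(* Padding by the empty set gives a disjoint sequence indexed by all of [nat]. *)
pose G k := if (k <= N)%N then E k else set0.
have tG : trivIset setT G.
  apply/trivIsetP => i j _ _.
  wlog ij : i j / (i < j)%N => [W|_].
    move=> ne; have [ij|ji] := ltnP i j; first exact: W.
    by rewrite setIC; apply: W; rewrite 1?eq_sym// ltn_neqAle eq_sym ne.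
  rewrite /G; case: (leqP j N) => jN; last by rewrite setI0.
  rewrite (_ : (i <= N)%N); last lia.
  apply/seteqP; split => // w [[_ H1] [/histE H2 _]].
  by apply: (H1 j); [lia|exact: H2].
have mG k : measurable (G k) by rewrite /G; case: ifP.
have GE : P (\big[setU/set0]_(k < N.+1) G k) =
    (\sum_(k < N.+1) p 1%N ^+ k * v (N - k)%N)%:E.
  rewrite (measure_bigsetU P mG tG N.+1) -sumEFin; apply: eq_bigr => k _.
  by rewrite /G -ltnS ltn_ord -E2; exact: prE.
rewrite -lee_fin -GE -(prE (measurable_no_return N)).
apply: le_measure; rewrite ?inE//.
- exact: bigsetU_measurable.
- exact: measurable_no_return.
rewrite -bigcup_mkord => w [k /= kN]; rewrite /G -ltnS kN => -[/histE H1 H2] a b hab.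
have [bk _|bk bo] := leqP b k; first by apply: H1; lia.
by exfalso; apply: (H2 b); [lia|].
Qed.

Lemma no_return_antimono N N' : (N <= N')%N -> pr (no_return N') <= pr (no_return N).
Proof.
move=> NN'; apply: le_pr; [exact: measurable_no_return|exact: measurable_no_return|].
by move=> w H a b hab; apply: H; lia.
Qed.

Lemma occupation_ge (L m : nat) : (0 < L)%N ->
  (forall k, (k < L)%N -> 2^-1 <= p 1%N ^+ k) ->
  (m * L)%:R <= (\sum_(k < m * L) matexp (k%:R * h) A o o) *
    (2 * \sum_(i < m.+1) pr (no_return (i * L))).
Proof.
move=> L0 pL.
apply: le_trans (renewal_cesaro (p := p) (m * L) p0 p_ge0 avoid_prob_ge0) _.
apply: ler_wpM2l; first by apply: sumr_ge0 => k _; exact: p_ge0.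
apply: (avoid_prob_sum_le (r := fun N => pr (no_return N))) => //.
- exact: avoid_prob_ge0.
- exact: pr_no_return_ge.
- exact: no_return_antimono.
Qed.

End Grid.

End Renewal.

(** * Dyadic refinement and the mean return time *)

Section DyadicGrid.
Context {R : realType}.

Lemma next_grid_point (t h : R) : 0 <= t -> 0 < h ->
  exists a : nat, t < a%:R * h <= t + h.
Proof.
move=> t0 h0; have /truncn_itv/andP[lo hi] : 0 <= t / h by rewrite divr_ge0// ltW.
exists (Num.truncn (t / h)).+1; apply/andP; split.
  by rewrite -ltr_pdivrMr.
by rewrite -natr1 mulrDl mul1r lerD2r -ler_pdivlMr.
Qed.

Lemma dyadic_small (delta e : R) n0 : 0 < delta -> 0 < e ->
  exists2 n, (n0 <= n)%N & delta / 2 ^+ n < e.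
Proof.
move=> d0 e0; have /truncn_itv/andP[_ hi] : 0 <= delta / e by rewrite divr_ge0// ltW.
exists ((Num.truncn (delta / e)).+1 + n0)%N; first by rewrite leq_addl.
rewrite ltr_pdivrMr ?exprn_gt0// mulrC -ltr_pdivrMr//; apply: lt_le_trans hi _.
rewrite -natrX ler_nat; set k := (_ + n0)%N.
by apply: leq_trans (ltnW (ltn_expl k (ltnSn 1))); rewrite leq_addr.
Qed.

End DyadicGrid.

Section MeanSojourn.
Context {R : realType} {Omega : choiceType}.
Variables (A : Omega -> Omega -> R) (o : Omega).
Context {d : measure_display} {T : measurableType d}.
Variables (P : probability T R) (X : R -> T -> Omega).
Hypothesis HM : markov_chain A o P X.
Variable delta : R.
Hypothesis delta0 : 0 < delta.

Let h n := delta / 2 ^+ n.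
Let h0 n : 0 < h n. Proof. by rewrite divr_gt0// exprn_gt0. Qed.
Let D i n : set T := no_return o X (h n) (i * 2 ^ n).

Let mD i n : measurable (D i n).
Proof. exact: (measurable_no_return HM (h0 n)). Qed.

Let D_mono i n : D i n.+1 `<=` D i n.
Proof.
move=> w H a b hab.
have e k : k%:R * h n = k.*2%:R * h n.+1.
  rewrite /h exprS -muln2 natrM; field.
  by rewrite expf_neq0.
rewrite !e; apply: H; rewrite ltn_double expnS mulnCA mul2n leq_double//.
Qed.

(** A path away from [o] at [tau] and back at [t] before time [i * delta] shows, by
    right-continuity, the same behaviour at grid points just after [tau] and [t] once the mesh is
    small. *)
Lemma no_return_le_return_time i w : (\bigcap_n D i n) w ->
  ((i%:R * delta)%:E <= return_time o X w)%E.
Proof.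
move=> Dw; apply: le_ereal_inf_tmp => _ [t [t0 Xt [tau /andP[tau0 taut] Xtau]] <-].
rewrite lee_fin leNgt; apply/negP => ti.
case: HM => _ rc _ _.
have [r /= r0 Hr] := rc w tau (ltW tau0).
have [r' /= r'0 Hr'] := rc w t (ltW t0).
(* Below this mesh, the next grid points after [tau] and [t] lie where the path is still constant,
   in the right order, and before [i * delta]. *)
pose e := Num.min (Num.min r r') (Num.min (t - tau) (i%:R * delta - t)).
have e0 : 0 < e by rewrite !lt_min r0 r'0 !subr_gt0 taut ti.
have [n _] := dyadic_small 0 delta0 e0.
rewrite -/(h n) !lt_min => /andP[/andP[hr hr'] /andP[htau hti]].
have [a /andP[a1 a2]] := next_grid_point (ltW tau0) (h0 n).
have [b /andP[b1 b2]] := next_grid_point (ltW t0) (h0 n).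
apply: Xtau; rewrite -(Hr (a%:R * h n))//=; last first.
  by rewrite ltr0_norm; lra.
apply: (Dw n I a b).
  have ie : i%:R * delta = (i * 2 ^ n)%:R * h n.
    by rewrite /h natrM natrX; field; rewrite expf_neq0.
  apply/andP; split.
    rewrite -(ltr_nat R) -(ltr_pM2r (h0 n)); lra.
  rewrite -(ler_nat R) -(ler_pM2r (h0 n)) -ie; lra.
rewrite (Hr' (b%:R * h n))//=.
by rewrite ltr0_norm; lra.
Qed.

Lemma return_time_ge0 w : (0 <= return_time o X w)%E.
Proof.
by apply: le_ereal_inf_tmp => _ [t [t0 _ _] <-]; rewrite lee_fin ltW.
Qed.

Hypothesis HT : (\int[P]_w return_time o X w < +oo)%E.

Let ET := fine (\int[P]_w return_time o X w).

Lemma sum_no_return_le m : \sum_(i < m.+1) pr P (\bigcap_n D i n) <= 1 + ET / delta.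
Proof.
have mDi i : measurable (\bigcap_n D i n) by exact: bigcapT_measurable.
have := @sum_measure_le_integral _ _ _ P (fun i => \bigcap_n D i n) _ delta m
  (ltW delta0) mDi return_time_ge0 no_return_le_return_time.
have -> : (\int[P]_w return_time o X w = ET%:E)%E.
  rewrite /ET fineK// ge0_fin_numE//; apply: integral_ge0 => w _.
  exact: return_time_ge0.
(* Layer 0 is not controlled by the integral and is bounded by 1. *)
rewrite big_ord_recl /= => H; apply: lerD.
  by rewrite -lee_fin -prE//; exact: probability_le1.
rewrite ler_pdivlMr// mulrC mulr_sumr -lee_fin -sumEFin; apply: le_trans H.
by apply: lee_sum => i _; rewrite EFinM -prE.
Qed.

Lemma cvg_no_return i : pr P (D i n) @[n --> \oo] --> pr P (\bigcap_n D i n).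
Proof.
apply: fine_cvg; rewrite -/(pr P (\bigcap_n D i n)) -prE; last first.
  exact: bigcapT_measurable.
apply: nonincreasing_cvg_mu => //.
- by rewrite (le_lt_trans (probability_le1 P (mD i 0%N)))// ltry.
- exact: bigcapT_measurable.
- apply/nonincreasing_seqP => n; apply/subsetPset; exact: D_mono.
Qed.

(** By Bernoulli's inequality a sojourn of [k] steps of length [h n] then has probability at least
    [1 - k * h n / (2 * delta)], which is at least 1/2 throughout a block of [2 ^ n] steps. *)
Hypothesis stay : forall t, 0 < t <= delta -> 1 - t / (2 * delta) <= matexp t A o o.

(** The factor 2 is that of [avoid_prob_sum_le]. In [2 + ET / delta], one unit comes from layer 0
    and one pays for replacing the limit events by those of a fine enough grid, which depends on
    [m]. *)
Lemma mean_sojourn_ge m n0 : exists2 n, (n0 <= n)%N &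
  (m * 2 ^ n)%:R <= (2 * (2 + ET / delta)) *
    \sum_(k < m * 2 ^ n) matexp (k%:R * h n) A o o.
Proof.
have /cvgrPdist_lt/(_ 1 ltr01)[N _ HN] :
    \sum_(i <- index_enum 'I_m.+1) pr P (D i n) @[n --> \oo] -->
    \sum_(i <- index_enum 'I_m.+1) pr P (\bigcap_n D i n).
  by apply: cvg_sumr => i; exact: cvg_no_return.
pose n := maxn n0 N; exists n; first by rewrite leq_maxl.
have {}HN : `|_| < 1 := HN n (leq_maxr _ _).
have hS : \sum_(i < m.+1) pr P (D i n) <= 2 + ET / delta.
  have := sum_no_return_le m; move: HN; rewrite ltr_norml => /andP[h1 h2]; lra.
rewrite [leRHS]mulrC.
have p_ge0 k : 0 <= matexp (k%:R * h n) A o o.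
  by rewrite -(transition_prob HM) ?pr_ge0// mulr_ge0// ltW.
apply: le_trans (occupation_ge HM (h0 n) m (_ : 0 < 2 ^ n)%N _) _.
- by rewrite expn_gt0.
- move=> k kn; rewrite mul1r.
  have hd : 0 < h n <= delta.
    rewrite h0/= ler_pdivrMr ?exprn_gt0//; apply: ler_peMr; first exact: ltW.
    by rewrite -natrX ler1n expn_gt0.
  have hx : 0 <= h n / (2 * delta) <= 1.
    move/andP: hd => [h1 h2]; apply/andP; split.
      by rewrite divr_ge0 ?mulr_ge0// ltW.
    by rewrite ler_pdivrMr ?mulr_gt0// mul1r; lra.
  have hk : k%:R * h n <= delta.
    rewrite mulrA ler_pdivrMr ?exprn_gt0// mulrC ler_pM2l// -natrX ler_nat ltnW//.
  have := stay hd; move/(fun H => lerXn2r k _ _ H) => Hk.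
  apply: le_trans (Hk _ _); rewrite ?nnegrE; last 2 first.
  + by move/andP: hx => [_ ?]; rewrite subr_ge0.
  + by have := p_ge0 1%N; rewrite mul1r.
  apply: le_trans (bernoulli_ge k hx).
  rewrite mulrA; have : k%:R * h n / (2 * delta) <= 2^-1; last lra.
  by rewrite ler_pdivrMr ?mulr_gt0//; lra.
apply: ler_wpM2l; first exact: sumr_ge0.
by rewrite ler_pM2l.
Qed.

End MeanSojourn.

Section MeanSojournExists.
Context {R : realType} {Omega : choiceType}.
Variables (A : Omega -> Omega -> R) (a : R).
Hypothesis row_le : forall i, (\esum_(j in [set: Omega]) `|A i j|%:E <= a%:E)%E.

Lemma matexp0 i j : matexp 0 A i j = matid i j.
Proof. exact: exps0. Qed.

Lemma is_derive_matexp0 i j : is_derive (0 : R) 1 (fun t => matexp t A i j) (A i j).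
Proof.
have := is_derive_exps 0 (matpow_bound1 row_le i j).
rewrite exps0 (_ : matpow A 1 i j = A i j)//.
rewrite matpowS /matpow/= (usum_fset_support (F := [fset j]%fset)).
  by rewrite big_seq_fset1 /matid eqxx mulr1.
by move=> m; rewrite inE /matid => /negPf->; rewrite mulr0.
Qed.

Lemma mean_sojourn o : positive_recurrent A -> exists C delta : R,
  [/\ 0 < C, 0 < delta & forall m n0, exists2 n, (n0 <= n)%N &
  (m * 2 ^ n)%:R <= C *
    \sum_(k < m * 2 ^ n) matexp (k%:R * (delta / 2 ^+ n)) A o o].
Proof.
move=> /(_ o)[d [T [P [X [HM _ HT]]]]].
have [r /= r0 Hr] := derivative_cvg_at_right (is_derive_matexp0 o o) ltr01.
have rr : r / 2 < r by rewrite ltr_pdivrMr// ltr_pMr// ltr1n.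
(* The difference quotient at 0 is within 1 of [A o o], hence above [- c]; [delta <= 1 / (2 * c)]
   turns this into [stay], and [r / 2] keeps [t] in the range of the approximation. *)
pose c := `|A o o| + 1.
have c0 : 0 < c by rewrite ltr_wpDl.
pose delta := Num.min (r / 2) (2 * c)^-1.
have delta0 : 0 < delta by rewrite lt_min divr_gt0// invr_gt0 mulr_gt0.
have stay t : 0 < t <= delta -> 1 - t / (2 * delta) <= matexp t A o o.
  move=> /andP[t0]; rewrite /delta le_min => /andP[tr tc].
  have := Hr t; rewrite /= sub0r normrN gtr0_norm// => /(_ (le_lt_trans tr rr) t0).
  rewrite matexp0 /matid eqxx mulr1n ltr_norml => /andP[h1 _].
  have h2 : - c < (matexp t A o o - 1) / t.
    have := ler_norm (- A o o); rewrite normrN /c; lra.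
  rewrite ltr_pdivlMr// in h2.
  have h3 : c * t <= t / (2 * delta).
    rewrite mulrC ler_pM2l// -[leLHS]invrK lef_pV2 ?posrE ?invr_gt0 ?mulr_gt0//.
    have : delta <= (2 * c)^-1 by rewrite /delta ge_min lexx orbT.
    rewrite invfM; lra.
  lra.
exists (2 * (2 + fine (\int[P]_w return_time o X w) / delta)), delta; split => //.
  rewrite mulr_gt0// ltr_wpDr// divr_ge0// ?(ltW delta0)// fine_ge0//.
  by apply: integral_ge0 => w _; exact: return_time_ge0.
by move=> m n0; exact: (mean_sojourn_ge HM delta0 HT stay).
Qed.

End MeanSojournExists.

(** * Summability of the reversible measure *)

Section TransitionMatrix.
Context {R : realType} {Omega : choiceType}.
Variables (A : Omega -> Omega -> R) (o : Omega).
Context {d : measure_display} {T : measurableType d}.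
Variables (P : probability T R) (X : R -> T -> Omega).
Hypothesis HM : markov_chain A o P X.

Lemma matexp_ge0_chain t i : 0 <= t -> 0 <= matexp t A i o.
Proof. by move=> t0; rewrite -(transition_prob HM)// pr_ge0. Qed.

Lemma matexp_sum_le1_chain t : 0 <= t ->
  (\esum_(i in [set: Omega]) (matexp t A i o)%:E <= 1)%E.
Proof.
move=> t0; apply: esum_le_fset => F; rewrite sumEFin lee_fin.
have m_at i := measurable_state HM i t0.
have aux s B : uniq s -> measurable B ->
    \sum_(i <- s) pr P (B `&` X t @^-1` [set i]) <= pr P B.
  elim: s B => [|i s IH] B /=; first by rewrite big_nil pr_ge0.
  move=> /andP[ins us] mB; rewrite big_cons (pr_split P mB (m_at i)) lerD2l.
  have mBC : measurable (B `&` ~` (X t @^-1` [set i])).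
    by apply: measurableI => //; exact: measurableC.
  apply: le_trans (IH _ us mBC); rewrite big_seq [leRHS]big_seq.
  apply: ler_sum => j js; apply: le_pr => //.
  - exact: measurableI.
  - exact: measurableI.
  - move=> w [Bw jw]; split => //; split => //= iw; move: jw => /= jw.
    by move: ins; rewrite -iw jw js.
rewrite (eq_bigr (fun i => pr P (setT `&` X t @^-1` [set i]))).
  apply: le_trans (aux _ _ (fset_uniq F) measurableT) _.
  by rewrite /pr probability_setT.
by move=> i _; rewrite setTI (transition_prob HM).
Qed.

(** The state at time [s] is summed over by countable subadditivity, for which [Omega] is
    enumerated. *)
Lemma matexp_add_le_chain s t i : ([set: Omega] #= [set: nat])%card ->
  0 <= s -> 0 <= t ->
  ((matexp (s + t) A i o)%:E <=
   \esum_(k in [set: Omega]) (matexp t A i k * matexp s A k o)%:E)%E.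
Proof.
move=> /card_set_bijP[f]; rewrite setTT_bijective => -[e fK eK] s0 t0.
have ebij : set_bij [set: nat] [set: Omega] e.
  by rewrite setTT_bijective; exists f.
 have st0 := addr_ge0 s0 t0.
have m_at k := measurable_state HM k s0.
have m_i := measurable_state HM i st0.
have E k : pr P (X (s + t) @^-1` [set i] `&` X s @^-1` [set k]) =
    matexp t A i k * matexp s A k o.
  have := @markov_past _ _ _ _ _ _ _ _ HM s t i k [::] s0 t0 (fun u => ltac:(by [])).
  rewrite past_cons (_ : past _ [::] = setT); last by apply/seteqP; split.
  by rewrite setIT /= (transition_prob HM).
have E0 k : (0 <= (matexp t A i k * matexp s A k o)%:E)%E.
  by rewrite lee_fin -E pr_ge0.
rewrite (reindex_esum [set: nat] setT e)// -nneseries_esumT//.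
rewrite -(transition_prob HM)// -(prE P m_i).
have mF k : measurable (X (s + t) @^-1` [set i] `&` X s @^-1` [set e k]).
  exact: measurableI.
apply: le_trans (measure_sigma_subadditive P mF m_i _) _.
  move=> w iw; case: ebij => _ _ /(_ (X s w) I)[k _ ek].
  by exists k => //; split.
by apply: lee_nneseries => // k _; rewrite -E -prE.
Qed.

End TransitionMatrix.

(** * Dirichlet form of the time-averaged law *)

Section AveragedDensity.
Context {R : realType} {Omega : choiceType}.
Variables (A : Omega -> Omega -> R) (X : Omega -> R).
Hypothesis X0 : forall i, 0 < X i.
Hypothesis K_ge0 : forall t i j, 0 <= t -> 0 <= matexp t A i j.
Hypothesis K_sum : forall t j, 0 <= t ->
  (\esum_(i in [set: Omega]) (matexp t A i j)%:E <= 1)%E.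
Hypothesis K_add : forall s t i j, 0 <= s -> 0 <= t ->
  ((matexp (s + t) A i j)%:E <=
   \esum_(k in [set: Omega]) (matexp t A i k * matexp s A k j)%:E)%E.
Hypothesis K_rev : forall t i j, X j * matexp t A i j = X i * matexp t A j i.
Variables (o : Omega) (h : R) (N : nat).
Hypotheses (h0 : 0 < h) (N0 : (0 < N)%N).

Definition average (i : Omega) : R :=
  N%:R^-1 * \sum_(k < N) matexp (k%:R * h) A i o.

Definition density (i : Omega) : R := average i / X i.

Let q k i := matexp (k%:R * h) A i o.
Let q_ge0 k i : 0 <= q k i.
Proof. by apply: K_ge0; rewrite mulr_ge0// ltW. Qed.

Let N0' : 0 < N%:R :> R. Proof. by rewrite ltr0n. Qed.
Let NV : 0 <= N%:R^-1 :> R. Proof. by rewrite invr_ge0 ltW. Qed.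

Let K_le1 t i j : 0 <= t -> matexp t A i j <= 1.
Proof.
move=> t0; rewrite -lee_fin; apply: le_trans (K_sum j t0).
by apply: (esum_ge1 (f := fun i => (matexp t A i j)%:E)) => k; rewrite lee_fin K_ge0.
Qed.

Lemma average_ge0 i : 0 <= average i.
Proof. by rewrite mulr_ge0// sumr_ge0// => k _; exact: q_ge0. Qed.

Lemma density_ge0 i : 0 <= density i.
Proof. by rewrite divr_ge0 ?average_ge0// ltW. Qed.

Lemma average_sum_le1 : (\esum_(i in [set: Omega]) (average i)%:E <= 1)%E.
Proof.
rewrite /average; under eq_esum do rewrite EFinM.
rewrite esumZ//; last by move=> i; rewrite lee_fin sumr_ge0// => k _; exact: q_ge0.
under eq_esum do rewrite -sumEFin.
rewrite esum_sum//; last by move=> i k _ _; rewrite lee_fin q_ge0.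
apply: (@le_trans _ _ (N%:R^-1%:E * \sum_(k < N) 1%E)%E).
  apply: lee_wpmul2l; first by rewrite lee_fin.
  by apply: lee_sum => k _; apply: K_sum; rewrite mulr_ge0// ltW.
by rewrite sumEFin -EFinM sumr_const card_ord mulVf// gt_eqF.
Qed.

(** Reversibility turns [matexp t A i o / X i] into [matexp t A o i / X o], whose numerator is a
    probability. *)
Lemma density_le i : density i <= (X o)^-1.
Proof.
rewrite /density ler_pdivrMr// /average mulrC ler_pdivrMr//.
have -> : (X o)^-1 * X i * N%:R = \sum_(k < N) (X o)^-1 * X i.
  by rewrite sumr_const card_ord mulr_natr.
apply: ler_sum => k _.
have kh : 0 <= k%:R * h by rewrite mulr_ge0// ltW.
have := K_le1 o i kh; rewrite -(ler_pM2l (X0 i)) -K_rev mulr1 => H.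
by rewrite -(ler_pM2l (X0 o)) mulrA mulfV ?mul1r// gt_eqF.
Qed.

(** One step of the kernel shifts the sum by one index: term 0 is left over, as the mass [1 / N] at
    [o], and the extra last term on the right is nonnegative. *)
Lemma average_step i :
  ((average i)%:E <= \esum_(j in [set: Omega]) (matexp h A i j * average j)%:E +
    (N%:R^-1 * (i == o)%:R)%:E)%E.
Proof.
have hh := ltW h0.
have -> : \esum_(j in [set: Omega]) (matexp h A i j * average j)%:E =
    (N%:R^-1%:E * \sum_(k < N) \esum_(j in [set: Omega]) (matexp h A i j * q k j)%:E)%E.
  rewrite -esum_sum; last by move=> j k _ _; rewrite lee_fin mulr_ge0// K_ge0.
  rewrite -esumZ//; last first.
    by move=> j; apply: sume_ge0 => k _; rewrite lee_fin mulr_ge0// K_ge0.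
  by apply: eq_esum => j _; rewrite sumEFin -EFinM -mulr_sumr mulrCA.
rewrite EFinM [X in (_ <= _ + X)%E]EFinM -muleDr//; last first.
  rewrite ge0_adde_def// inE ?lee_fin//; apply: sume_ge0 => k _; apply: esum_ge0 => j _.
  by rewrite lee_fin mulr_ge0// K_ge0.
apply: lee_wpmul2l; first by rewrite lee_fin.
case: (N) N0 => // M _; rewrite big_ord_recl mul0r matexp0 /matid EFinD addeC.
apply: leeD => //; rewrite -sumEFin big_ord_recr/=.
apply: (@le_trans _ _ (\sum_(k < M) \esum_(j in [set: Omega]) (matexp h A i j * q k j)%:E)%E).
  apply: lee_sum => k _.
  have -> : (bump 0 k)%:R * h = k%:R * h + h.
    by rewrite /bump/= add1n -natr1 mulrDl mul1r.
  by apply: K_add => //; rewrite mulr_ge0.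
by rewrite leeDl//; apply: esum_ge0 => j _; rewrite lee_fin mulr_ge0// K_ge0.
Qed.

Let Q i j := X j * matexp h A i j.

Let Q_ge0 i j : 0 <= Q i j.
Proof. by rewrite mulr_ge0 ?K_ge0// ltW. Qed.

Let S := \esum_(i in [set: Omega]) (density i * average i)%:E.

Let S_fin : (S < +oo)%E.
Proof.
apply: (@le_lt_trans _ _ (\esum_(i in [set: Omega]) ((X o)^-1%:E * (average i)%:E))%E).
  by apply: le_esum => i _; rewrite -EFinM lee_fin ler_wpM2r ?average_ge0// density_le.
rewrite esumZ//; last by move=> i; rewrite lee_fin average_ge0.
  rewrite lte_mul_pinfty ?lee_fin// ?invr_ge0 ?(ltW (X0 o))//.
  exact: le_lt_trans average_sum_le1 (ltry _).
by rewrite invr_ge0 ltW.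
Qed.

Let XdE i : X i * density i = average i.
Proof. by rewrite /density mulrC divfK// gt_eqF. Qed.

(* Since [X] is reversible for the kernel [K] of step [h], the Dirichlet form
   of [density] is [<density, (1 - K) average>], and [average - K average] is
   at most [1 / N] at [o] and nonpositive elsewhere. *)
Lemma dirichlet_le a b :
  X b * matexp h A a b * (density a - density b) ^+ 2 <= 2 / (N%:R * X o).
Proof.
have hh := ltW h0.
pose u := density.
pose E := \esum_(i in [set: Omega]) \esum_(j in [set: Omega])
  (Q i j * (u i - u j) ^+ 2)%:E.
pose W := \esum_(i in [set: Omega]) \esum_(j in [set: Omega])
  (Q i j * (2 * (u i * u j)))%:E.
have u0 : forall i, 0 <= u i := density_ge0.
have Quu i j : 0 <= Q i j * (u i * u j) by rewrite mulr_ge0// mulr_ge0.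
have W0 i j : 0 <= Q i j * (2 * (u i * u j)) by rewrite mulr_ge0// mulr_ge0// mulr_ge0.
have E0 i j : 0 <= Q i j * (u i - u j) ^+ 2 by rewrite mulr_ge0// sqr_ge0.
have QX j : (\esum_(i in [set: Omega]) (Q i j * u j ^+ 2)%:E <=
    (u j * average j)%:E)%E.
  have -> : (u j * average j)%:E = ((X j * u j ^+ 2)%:E * 1)%E.
    by rewrite mule1 -XdE -/(u j); congr (_%:E); ring.
  under eq_esum => i _.
    rewrite (_ : Q i j * _ = (X j * u j ^+ 2) * matexp h A i j); last by rewrite /Q; ring.
    rewrite EFinM; over.
  have XU : 0 <= X j * u j ^+ 2 by rewrite mulr_ge0 ?sqr_ge0// ltW.
  rewrite esumZ//; last by move=> i; rewrite lee_fin K_ge0.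
  by apply: lee_wpmul2l; [rewrite lee_fin|exact: K_sum].
(* [W] is added instead of subtracted, to stay with nonnegative extended reals:
   [(u i - u j) ^+ 2 + 2 * (u i * u j)] splits into two squares, and each resulting sum is at most
   [S] because columns of the kernel sum to at most 1. *)
have EW : (E + W <= S + S)%E.
  rewrite /E /W -esumD; last 2 first.
  - by move=> i _; apply: esum_ge0 => j _; rewrite lee_fin.
  - by move=> i _; apply: esum_ge0 => j _; rewrite lee_fin.
  under eq_esum => i _.
    rewrite -esumD; [|by move=> j _; rewrite lee_fin|by move=> j _; rewrite lee_fin].
    under eq_esum => j _.
      rewrite -EFinD (_ : _ + _ = Q i j * u j ^+ 2 + Q i j * u i ^+ 2); last by ring.
      rewrite EFinD; over.
    rewrite esumD; last 2 first.
    - by move=> j _; rewrite lee_fin mulr_ge0// sqr_ge0.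
    - by move=> j _; rewrite lee_fin mulr_ge0// sqr_ge0.
    over.
  rewrite esumD; last 2 first.
  - by move=> i _; apply: esum_ge0 => j _; rewrite lee_fin mulr_ge0// sqr_ge0.
  - by move=> i _; apply: esum_ge0 => j _; rewrite lee_fin mulr_ge0// sqr_ge0.
  apply: leeD.
    rewrite esum_exchange; last by move=> i j; rewrite lee_fin mulr_ge0// sqr_ge0.
    by apply: le_esum => j _; exact: QX.
  apply: le_esum => i _; apply: le_trans (QX i).
  by apply: le_esum => j _; rewrite lee_fin /Q K_rev.
(* [average_step] multiplied by [u i] and summed; the term at [o] costs [u o / N], and [u o] is at
   most [1 / X o]. *)
have SW : (S + S <= W + (2 * (N%:R^-1 * (X o)^-1))%:E)%E.
  have SW1 : (S <= \esum_(i in [set: Omega]) \esum_(j in [set: Omega])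
      (Q i j * (u i * u j))%:E + (N%:R^-1 * (X o)^-1)%:E)%E.
    apply: (@le_trans _ _ (\esum_(i in [set: Omega])
      (\esum_(j in [set: Omega]) (Q i j * (u i * u j))%:E +
       (u i * (N%:R^-1 * (i == o)%:R))%:E))%E).
      apply: le_esum => i _.
      have -> : \esum_(j in [set: Omega]) (Q i j * (u i * u j))%:E =
          ((u i)%:E * \esum_(j in [set: Omega]) (matexp h A i j * average j)%:E)%E.
        rewrite -esumZ//; last by move=> j; rewrite lee_fin mulr_ge0 ?K_ge0// average_ge0.
        by apply: eq_esum => j _; rewrite -EFinM -XdE /Q; congr (_%:E); rewrite -/u; ring.
      rewrite [X in (_ <= _ + X)%E]EFinM EFinM -muleDr//; last first.
        rewrite ge0_adde_def// inE ?lee_fin ?mulr_ge0//.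
        by apply: esum_ge0 => j _; rewrite lee_fin mulr_ge0 ?K_ge0// average_ge0.
      by apply: lee_wpmul2l; [rewrite lee_fin u0|exact: average_step].
    rewrite esumD; last 2 first.
    - by move=> i _; apply: esum_ge0 => j _; rewrite lee_fin.
    - by move=> i _; rewrite lee_fin mulr_ge0// mulr_ge0.
    apply: leeD => //.
    rewrite (esum_fset_support (F := [fset o]%fset)).
    - rewrite big_seq_fset1 eqxx mulr1 lee_fin mulrC ler_wpM2l//.
      exact: density_le.
    - by move=> i; rewrite lee_fin mulr_ge0// mulr_ge0.
    - by move=> i; rewrite inE => /negPf->; rewrite mulr0 mulr0.
  have -> : W = (\esum_(i in [set: Omega]) \esum_(j in [set: Omega])
      (Q i j * (u i * u j))%:E + \esum_(i in [set: Omega]) \esum_(j in [set: Omega])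
      (Q i j * (u i * u j))%:E)%E.
    rewrite -esumD; last 2 first.
    - by move=> i _; apply: esum_ge0 => j _; rewrite lee_fin.
    - by move=> i _; apply: esum_ge0 => j _; rewrite lee_fin.
    apply: eq_esum => i _; rewrite -esumD; last 2 first.
    - by move=> j _; rewrite lee_fin.
    - by move=> j _; rewrite lee_fin.
    by apply: eq_esum => j _; rewrite -EFinD; congr (_%:E); ring.
  apply: le_trans (leeD SW1 SW1) _.
  rewrite addeACA -EFinD leeD2l// lee_fin; lra.
have S0 : (0 <= S)%E.
  by apply: esum_ge0 => i _; rewrite lee_fin mulr_ge0 ?u0// average_ge0.
have E0' : (0 <= E)%E.
  by apply: esum_ge0 => i _; apply: esum_ge0 => j _; rewrite lee_fin.
have W0' : (0 <= W)%E.
  by apply: esum_ge0 => i _; apply: esum_ge0 => j _; rewrite lee_fin.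
have Eab : ((Q a b * (u a - u b) ^+ 2)%:E <= E)%E.
  apply: (@le_trans _ _ (\esum_(j in [set: Omega]) (Q a j * (u a - u j) ^+ 2)%:E)).
    by apply: (esum_ge1 (f := fun j => (Q a j * (u a - u j) ^+ 2)%:E)) => j; rewrite lee_fin.
  apply: (esum_ge1 (f := fun i => \esum_(j in [set: Omega]) (Q i j * (u i - u j) ^+ 2)%:E)) => i.
  by apply: esum_ge0 => j _; rewrite lee_fin.
have -> : 2 / (N%:R * X o) = 2 * (N%:R^-1 * (X o)^-1) by rewrite invfM.
move: S E W S0 E0' W0' S_fin EW SW Eab => [s| |] [e| |] [w| |]//=.
by rewrite -!EFinD !lee_fin => _ _ _ _ h1 h2 h3; rewrite -/(Q a b) -/(u a) -/(u b); lra.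
Qed.

End AveragedDensity.

Section FiniteMass.
Context {R : realType} {Omega : choiceType}.
Variables (A : Omega -> Omega -> R) (a : R) (X : Omega -> R).
Hypothesis countable : ([set: Omega] #= [set: nat])%card.
Hypothesis row_le : forall i, (\esum_(j in [set: Omega]) `|A i j|%:E <= a%:E)%E.
Hypothesis col_fin : forall j, (\esum_(i in [set: Omega]) `|A i j|%:E < +oo)%E.
Hypothesis X0 : forall i, 0 < X i.
Hypothesis A_rev : forall i j, X j * A i j = X i * A j i.
Hypothesis Hrec : positive_recurrent A.
Hypothesis Hirr : forall i j,
  exists2 p : seq Omega, path (fun k l => 0 < A l k) i p & last i p = j.

Let K_ge0 t i j : 0 <= t -> 0 <= matexp t A i j.
Proof. have [d [T [P [Y [HM _ _]]]]] := Hrec j; exact: (matexp_ge0_chain HM). Qed.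

Let K_sum t j : 0 <= t -> (\esum_(i in [set: Omega]) (matexp t A i j)%:E <= 1)%E.
Proof. have [d [T [P [Y [HM _ _]]]]] := Hrec j; exact: (matexp_sum_le1_chain HM). Qed.

Let K_add s t i j : 0 <= s -> 0 <= t -> ((matexp (s + t) A i j)%:E <=
   \esum_(k in [set: Omega]) (matexp t A i k * matexp s A k j)%:E)%E.
Proof. have [d [T [P [Y [HM _ _]]]]] := Hrec j; exact: (matexp_add_le_chain HM). Qed.

Let K_rev := matexp_reversible row_le col_fin A_rev.

Lemma matexp_offdiag_ge k l : k != l -> 0 < A l k ->
  exists2 r : R, 0 < r & forall h, 0 < h < r -> h * A l k / 2 <= matexp h A l k.
Proof.
move=> kl Alk; have e0 : 0 < A l k / 2 by rewrite divr_gt0.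
have [r /= r0 Hr] := derivative_cvg_at_right (is_derive_matexp0 row_le l k) e0.
exists r => // h /andP[h0 hr]; have := Hr h.
rewrite /= sub0r normrN gtr0_norm// => /(_ hr h0).
rewrite matexp0 /matid eq_sym (negPf kl) subr0 ltr_norml => /andP[h1 _].
have : A l k / 2 < matexp h A l k / h by lra.
rewrite ltr_pdivlMr// => h2; apply: ltW; apply: le_lt_trans h2; lra.
Qed.

Lemma reversible_mass_le (o : Omega) :
  exists M, forall F : {fset Omega}, \sum_(i <- F) X i <= M.
Proof.
have [C [delta [C0 delta0 HC]]] := mean_sojourn row_le o Hrec.
have /choice[n Hn] : forall m, exists n, (m <= n)%N /\
    (m * 2 ^ n)%:R <= C *
      \sum_(k < m * 2 ^ n) matexp (k%:R * (delta / 2 ^+ n)) A o o.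
  by move=> m; have [n] := HC m m; exists n.
(* Stage [m] averages over a total time [m * delta], which makes the Dirichlet form small relative
   to the mesh; [m <= n m] sends the mesh to 0, where the kernel is bounded below to first order. *)
pose h m := delta / 2 ^+ n m; pose N m := (m * 2 ^ n m)%N.
have h0 m : 0 < h m by rewrite divr_gt0// exprn_gt0.
pose u m := density A X o (h m) (N m).
have N0 m : (0 < m)%N -> (0 < N m)%N by move=> m0; rewrite muln_gt0 m0 expn_gt0.
have hN m : h m * (N m)%:R = m%:R * delta.
  by rewrite /h /N natrM natrX; field; rewrite expf_neq0.
have uo m : (0 < m)%N -> (C * X o)^-1 <= u m o.
  move=> m0; rewrite /u /density invfM ler_pM2r ?invr_gt0//.
  rewrite /average mulrC ler_pdivlMr ?ltr0n ?N0// mulrC ler_pdivrMr// mulrC.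
  by have [_] := Hn m.
have h_small r : 0 < r -> \forall m \near \oo, h m < r.
  move=> r0; have [k _ hk] := dyadic_small 0 delta0 r0.
  exists k => // m /= km; apply: le_lt_trans hk; rewrite /h ler_pM2l//.
  rewrite lef_pV2 ?posrE ?exprn_gt0// ler_weXn2l ?ler1n//.
  by have [mn _] := Hn m; exact: leq_trans mn.
have m_large c : \forall m \near \oo, c < m%:R :> R.
  exact: nbhs_infty_gtr.
have close_edge k l : 0 < A l k ->
    forall e, 0 < e -> \forall m \near \oo, `|u m l - u m k| < e.
  move=> Alk e e0; have [->|kl] := eqVneq k l.
    by near=> m; rewrite subrr normr0.
  have [r r0 Hr] := matexp_offdiag_ge kl Alk.
  (* A gap of at least [e] across the link would give, through [dirichlet_le] and [hN], that
     [m <= c]. *)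
  pose c := 4 / (X k * A l k * X o * delta * e ^+ 2).
  near=> m.
  have m0 : (0 < m)%N by near: m; exists 1%N.
  have hr : h m < r by near: m; exact: h_small.
  have cm : c < m%:R by near: m; exact: m_large.
  have D := dirichlet_le X0 K_ge0 K_sum K_add K_rev o (h0 m) (N0 m m0) l k.
  have Kh := Hr (h m) ltac:(by rewrite h0 hr).
  rewrite -/(u m) in D; rewrite ltNge; apply/negP => ue.
  have u2 : e ^+ 2 <= (u m l - u m k) ^+ 2.
    by rewrite -[leRHS](real_normK (num_real _)) lerXn2r ?nnegrE// ltW.
  have e2 : 0 < e ^+ 2 by rewrite exprn_gt0.
  have D1 : X k * (h m * A l k / 2) * e ^+ 2 <= 2 / ((N m)%:R * X o).
    apply: le_trans D; apply: (@le_trans _ _ (X k * matexp (h m) A l k * e ^+ 2)).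
      by rewrite ler_pM2r// ler_pM2l.
    by apply: ler_wpM2l => //; rewrite mulr_ge0 ?K_ge0// ltW.
  have Nm : 0 < (N m)%:R :> R by rewrite ltr0n N0.
  rewrite ler_pdivlMr ?mulr_gt0// in D1.
  move: cm; rewrite /c ltr_pdivrMr ?mulr_gt0//.
  have -> : m%:R * (X k * A l k * X o * delta * e ^+ 2) =
    2 * (X k * (h m * A l k / 2) * e ^+ 2 * ((N m)%:R * X o)).
    transitivity (m%:R * delta * (X k * A l k * X o * e ^+ 2)); first by ring.
    by rewrite -hN; field.
  lra.
have close i : forall e, 0 < e -> \forall m \near \oo, `|u m i - u m o| < e.
  have [p hp <-] := Hirr o i.
  elim/last_ind: p hp => [|p j IH] /=.
    by move=> _ e e0; near=> m; rewrite subrr normr0.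
  rewrite rcons_path last_rcons => /andP[hp hj] e e0.
  have e2 : 0 < e / 2 by rewrite divr_gt0.
  near=> m.
  have h1 : `|u m j - u m (last o p)| < e / 2 by near: m; exact: close_edge.
  have h2 : `|u m (last o p) - u m o| < e / 2 by near: m; exact: IH.
  have -> : u m j - u m o = (u m j - u m (last o p)) + (u m (last o p) - u m o) by ring.
  by apply: le_lt_trans (ler_normD _ _) _; lra.
have Co : 0 < C * X o by rewrite mulr_gt0.
exists (2 * (C * X o)) => F.
have closeF (s : seq Omega) : \forall m \near \oo,
    forall i, i \in s -> (2 * (C * X o))^-1 <= u m i.
  elim: s => [|j s IH]; first by near=> m.
  (* Half of the lower bound for the density at [o]; the other half absorbs its variation from [o]
     to [j]. *)
  have e0 : 0 < (2 * (C * X o))^-1 by rewrite invr_gt0 mulr_gt0.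
  near=> m.
  have IHm : forall i, i \in s -> (2 * (C * X o))^-1 <= u m i by near: m.
  move=> i; rewrite inE => /predU1P[->|]; last exact: IHm.
  have m0 : (0 < m)%N by near: m; exists 1%N.
  have h1 : `|u m j - u m o| < (2 * (C * X o))^-1 by near: m; exact: close.
  have := uo m m0; move: h1; rewrite ltr_norml invfM => /andP[h1 _]; lra.
have [m [m0 Hm]] : exists m, (0 < m)%N /\
    forall i, i \in (F : seq Omega) -> (2 * (C * X o))^-1 <= u m i.
  have [k _ Hk] := closeF F.
  by exists k.+1; split => //; apply: Hk => /=.
have av := average_sum_le1 K_ge0 K_sum o (h0 m) (N0 m m0).
have avF : \sum_(i <- F) average A o (h m) (N m) i <= 1.
  rewrite -lee_fin; apply: le_trans av; apply: esum_ge_fset => i.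
  exact (average_ge0 K_ge0 o (h0 m) (N0 m m0) i).
rewrite -(ler_pM2l (_ : 0 < (2 * (C * X o))^-1)) ?invr_gt0 ?mulr_gt0//.
rewrite mulVf ?gt_eqF ?mulr_gt0//; apply: le_trans avF.
rewrite mulr_sumr big_seq [leRHS]big_seq; apply: ler_sum => i iF.
by rewrite -ler_pdivlMr//; exact: Hm.
Unshelve. all: by end_near.
Qed.

End FiniteMass.

(** * Stationary vectors *)

Section Generator.
Context {R : realType} {Omega : choiceType}.
Variable gamma : Omega -> Omega -> R.
Hypothesis gamma_ge0 : forall i j, 0 <= gamma i j.
Hypothesis gamma_diag : forall i, gamma i i = 0.
Hypothesis Gsum : abs_summable (generator gamma).

Let G := generator gamma.

Lemma generator_sum_fin :
  (\esum_(i in [set: Omega]) \esum_(j in [set: Omega]) `|G i j|%:E < +oo)%E.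
Proof.
rewrite esum_esum//; apply: le_lt_trans Gsum.
rewrite (_ : [set: Omega] `*`` (fun=> [set: Omega]) = setT)//.
by apply/seteqP; split.
Qed.

Lemma generator_row_le : exists a, forall i,
  (\esum_(j in [set: Omega]) `|G i j|%:E <= a%:E)%E.
Proof.
exists (fine (\esum_(i in [set: Omega]) \esum_(j in [set: Omega]) `|G i j|%:E)) => i.
rewrite fineK.
  apply: (esum_ge1 (f := fun i => \esum_(j in [set: Omega]) `|G i j|%:E)) => k.
  by apply: esum_ge0 => j _; rewrite lee_fin.
rewrite ge0_fin_numE ?generator_sum_fin//.
by apply: esum_ge0 => k _; apply: esum_ge0 => j _; rewrite lee_fin.
Qed.

Lemma generator_col_fin j : (\esum_(i in [set: Omega]) `|G i j|%:E < +oo)%E.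
Proof.
apply: le_lt_trans generator_sum_fin; apply: le_esum => i _.
by apply: (esum_ge1 (f := fun j => `|G i j|%:E)) => k; rewrite lee_fin.
Qed.

Lemma gamma_le_generator i j : gamma i j <= `|G j i|.
Proof.
rewrite /G /generator; case: eqVneq => [->|_]; first by rewrite gamma_diag.
exact: ler_norm.
Qed.

Lemma gamma_sum_fin :
  (\esum_(i in [set: Omega]) \esum_(j in [set: Omega]) (gamma i j)%:E < +oo)%E.
Proof.
apply: le_lt_trans generator_sum_fin; rewrite esum_exchange; last by move=> i j; rewrite lee_fin.
by apply: le_esum => i _; apply: le_esum => j _; rewrite lee_fin gamma_le_generator.
Qed.

Lemma gamma_row_fin i : (\esum_(j in [set: Omega]) (gamma i j)%:E < +oo)%E.
Proof.
apply: le_lt_trans (generator_col_fin i); apply: le_esum => j _.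
by rewrite lee_fin gamma_le_generator.
Qed.

Definition exit_rate i := usum (gamma i).

Lemma exit_rateE i : \esum_(j in [set: Omega]) (gamma i j)%:E = (exit_rate i)%:E.
Proof. by rewrite /exit_rate usum_ge0E// -esum_fin//; exact: gamma_row_fin. Qed.

Lemma exit_rate_ge0 i : 0 <= exit_rate i.
Proof. by rewrite -lee_fin -exit_rateE; apply: esum_ge0 => j _; rewrite lee_fin. Qed.

Lemma inflow_fin (Q : Omega -> R) (M : R) i : (forall j, 0 <= Q j <= M) ->
  (\esum_(j in [set: Omega]) (gamma j i * Q j)%:E < +oo)%E.
Proof.
move=> QM; have M0 : 0 <= M by have /andP[] := QM i; apply: le_trans.
apply: (@le_lt_trans _ _ (\esum_(j in [set: Omega]) (M%:E * `|G i j|%:E))%E).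
  apply: le_esum => j _; rewrite -EFinM lee_fin mulrC; have /andP[q0 qM] := QM j.
  by apply: ler_pM => //; exact: gamma_le_generator.
rewrite esumZ// lte_mul_pinfty// ?lee_fin//.
have [a ha] := generator_row_le; exact: le_lt_trans (ha i) (ltry _).
Qed.

(** Inflow minus outflow; the outflow is encoded as a family supported at the diagonal index, so
    that [usum_decomp] applies. *)
Lemma matvec_generator (Q : Omega -> R) (M : R) i : (forall j, 0 <= Q j <= M) ->
  matvec G Q i = fine (\esum_(j in [set: Omega]) (gamma j i * Q j)%:E) -
    exit_rate i * Q i.
Proof.
move=> QM; have Q0 j : 0 <= Q j by have /andP[] := QM j.
have dE : \esum_(j in [set: Omega]) ((i == j)%:R * (exit_rate i * Q i))%:E =
    (exit_rate i * Q i)%:E.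
  rewrite (esum_fset_support (F := [fset i]%fset)).
  - by rewrite big_seq_fset1 eqxx mul1r.
  - by move=> j; rewrite lee_fin !mulr_ge0// exit_rate_ge0.
  - by move=> j; rewrite inE eq_sym => /negPf->; rewrite mul0r.
rewrite /matvec (@usum_decomp _ _ _ (fun j => gamma j i * Q j)
    (fun j => (i == j)%:R * (exit_rate i * Q i))).
- by rewrite dE.
- by move=> j; rewrite mulr_ge0.
- by move=> j; rewrite !mulr_ge0// exit_rate_ge0.
- move=> j; rewrite /G /generator; case: eqVneq => [<-|ij].
    by rewrite gamma_diag mul0r mul1r sub0r mulNr.
  by rewrite mul0r subr0.
- exact: inflow_fin QM.
- by rewrite dE ltry.
Qed.

Lemma prob_vector_le1 (Q : Omega -> R) : prob_vector Q -> forall j, 0 <= Q j <= 1.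
Proof.
move=> [Q0 Q1] j; rewrite Q0/= -lee_fin -Q1 /l1norm.
rewrite -[leLHS](_ : `|Q j|%:E = _); last by rewrite ger0_norm.
by apply: (esum_ge1 (f := fun i => `|Q i|%:E)) => k; rewrite lee_fin.
Qed.

Lemma prob_vector_esum (Q : Omega -> R) : prob_vector Q ->
  \esum_(i in [set: Omega]) (Q i)%:E = 1%E.
Proof.
by move=> [Q0 <-]; apply: eq_esum => i _; rewrite ger0_norm.
Qed.

Lemma stationary_balance (Q : Omega -> R) : stationary G Q ->
  forall i, \esum_(j in [set: Omega]) (gamma j i * Q j)%:E = (exit_rate i * Q i)%:E.
Proof.
move=> [PQ HQ] i; have Q1 := prob_vector_le1 PQ.
have := HQ i; rewrite (matvec_generator i Q1) => /eqP; rewrite subr_eq0 => /eqP <-.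
apply: esum_fin; last exact: inflow_fin Q1.
by move=> j; rewrite mulr_ge0//; have /andP[] := Q1 j.
Qed.

Hypothesis Hirr : irreducible gamma.

(* The positive part of the difference of two stationary vectors satisfies the
   balance inequality [exit_rate i * D i <= inflow into i]; both sides have the
   same finite sum, so it is an equality, and hence the zeros of [D] propagate
   backwards along the links. *)
Lemma stationary_unique (Q Q' : Omega -> R) : stationary G Q -> stationary G Q' ->
  Q = Q'.
Proof.
move=> SQ SQ'; have [PQ _] := SQ; have [PQ' _] := SQ'.
have eq_of_le (P P' : Omega -> R) : prob_vector P -> prob_vector P' ->
    (forall i, P i <= P' i) -> P = P'.
  move=> HP HP' le; apply/funext; apply: esum_ge0_eq => //.
  - by case: HP.
  - by rewrite prob_vector_esum// ltry.
  - by rewrite !prob_vector_esum.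
pose D i := Num.max (Q i - Q' i) 0.
have D0 i : 0 <= D i by exact: max0_ge0.
have Q1 := prob_vector_le1 PQ; have Q1' := prob_vector_le1 PQ'.
have D1 i : 0 <= D i <= 1.
  rewrite D0/= /D ge_max ler01 andbT; have /andP[? ?] := Q1 i.
  have /andP[? ?] := Q1' i; lra.
have QD i : Q i <= Q' i + D i.
  by have : Q i - Q' i <= D i; [rewrite /D le_max lexx|lra].
pose f i := exit_rate i * D i.
pose g i := fine (\esum_(j in [set: Omega]) (gamma j i * D j)%:E).
have gE i : \esum_(j in [set: Omega]) (gamma j i * D j)%:E = (g i)%:E.
  apply: esum_fin; last exact: inflow_fin D1.
  by move=> j; rewrite mulr_ge0.
have f0 i : 0 <= f i by rewrite mulr_ge0// exit_rate_ge0.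
have fg i : f i <= g i.
  (* Where [D i] vanishes the bound is trivial; elsewhere [D i = Q i - Q' i] and the balance
     equations at [i] are compared. *)
  have [qi|qi] := leP (Q i - Q' i) 0.
    rewrite /f [D i]max_r// mulr0 -lee_fin -gE.
    by apply: esum_ge0 => j _; rewrite lee_fin mulr_ge0.
  rewrite /f {1}/D max_l ?(ltW qi)// mulrBr lerBlDl -lee_fin EFinD -gE.
  rewrite -!stationary_balance// -esumD.
  - apply: le_esum => j _; rewrite -EFinD lee_fin -mulrDr.
    by apply: ler_wpM2l; rewrite ?QD.
  - by move=> j _; rewrite lee_fin mulr_ge0//; have /andP[] := Q1' j.
  - by move=> j _; rewrite lee_fin mulr_ge0.
have fE i : (f i)%:E = \esum_(j in [set: Omega]) (gamma i j * D i)%:E.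
  rewrite /f mulrC EFinM -exit_rateE -esumZ//.
    by apply: eq_esum => j _; rewrite mulrC.
  by move=> j; rewrite lee_fin.
have ffin : (\esum_(i in [set: Omega]) (f i)%:E < +oo)%E.
  apply: le_lt_trans gamma_sum_fin; apply: le_esum => i _; rewrite fE.
  by apply: le_esum => j _; rewrite lee_fin ler_piMr//; have /andP[] := D1 i.
(* Both sides are the total of [gamma i j * D i], summed by target or by source. *)
have gf : \esum_(i in [set: Omega]) (g i)%:E = \esum_(i in [set: Omega]) (f i)%:E.
  under eq_esum do rewrite -gE.
  under [RHS]eq_esum do rewrite fE.
  by rewrite [RHS]esum_exchange// => i j; rewrite lee_fin mulr_ge0.
have eqfg := esum_ge0_eq f0 fg ffin gf.
have back i j : 0 < gamma j i -> D i = 0 -> D j = 0.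
  move=> gji Di; have gi0 : g i = 0 by rewrite -eqfg /f Di mulr0.
  have : gamma j i * D j <= g i.
    rewrite -lee_fin -gE; apply: (esum_ge1 (f := fun j => (gamma j i * D j)%:E)) => k.
    by rewrite lee_fin mulr_ge0.
  rewrite gi0 pmulr_rle0// => Dj; by apply/eqP; rewrite eq_le Dj D0.
have backp i j : D i = 0 -> D j = 0.
  have [p] := Hirr j i; elim: p j => [|k p IH] j /=; first by move=> _ ->.
  by move=> /andP[jk kp] lp Di; exact: back jk (IH _ kp lp Di).
(* One zero of [D] spreads to all states and gives [Q <= Q']; without zeros [Q' <= Q]. Ordered
   probability vectors coincide. *)
have [[i Di]|/forallNP nD] := pselect (exists i, D i = 0).
  apply: eq_of_le => // j.
  by have := QD j; rewrite (backp i j Di) addr0.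
apply/esym; apply: eq_of_le => // j.
have Dj : 0 < D j by rewrite lt_def D0 andbT; apply/eqP; exact: nD.
by move: Dj; rewrite /D lt_max ltxx orbF subr_gt0 => /ltW.
Qed.

Variable X : Omega -> R.
Hypothesis X0 : forall i, 0 < X i.
Hypothesis X_rev : forall i j, X j * gamma j i = X i * gamma i j.
Variable M : R.
Hypothesis X_le : forall F : {fset Omega}, \sum_(i <- F) X i <= M.

(** Detailed balance turns the inflow at [i] into [X i] times its exit rate. *)
Lemma normalized_stationary (o : Omega) : exists2 m : R, 0 < m &
  stationary G (fun i => X i / m).
Proof.
have Xge0 i : 0 <= X i by exact: ltW.
have Xfin : (\esum_(i in [set: Omega]) (X i)%:E < +oo)%E.
  apply: (@le_lt_trans _ _ M%:E); last exact: ltry.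
  by apply: esum_le_fset => F; rewrite sumEFin lee_fin.
pose m := fine (\esum_(i in [set: Omega]) (X i)%:E).
have mE : \esum_(i in [set: Omega]) (X i)%:E = m%:E by exact: esum_fin.
have m0 : 0 < m.
  apply: lt_le_trans (X0 o) _; rewrite -lee_fin -mE.
  by apply: (esum_ge1 (f := fun i => (X i)%:E)) => i; rewrite lee_fin.
have PX : prob_vector (fun i => X i / m).
  split=> [i|]; first by rewrite divr_ge0// ltW.
  rewrite /l1norm; under eq_esum => i _.
    rewrite ger0_norm; last by rewrite divr_ge0// ltW.
    rewrite mulrC EFinM; over.
  by rewrite esumZ ?mE -?EFinM ?mulVf ?gt_eqF// invr_ge0 ltW.
exists m => //; split=> // i.
rewrite (matvec_generator i (prob_vector_le1 PX)).
have -> : \esum_(j in [set: Omega]) (gamma j i * (X j / m))%:E =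
    ((X i / m)%:E * \esum_(j in [set: Omega]) (gamma i j)%:E)%E.
  rewrite -esumZ; [|by rewrite divr_ge0// ltW|by move=> j; rewrite lee_fin].
  by apply: eq_esum => j _; rewrite -EFinM mulrA (mulrC (gamma j i)) X_rev mulrAC.
by rewrite exit_rateE -EFinM/= mulrC subrr.
Qed.

End Generator.

(** * Finite systems *)

Section RealFunctions.
Context {R : realType}.
Implicit Types (f df : R -> R).

Lemma derive_mean_value f df (x y : R) : (forall z : R, is_derive z 1 f (df z)) -> x < y ->
  exists2 c, x < c < y & f y - f x = df c * (y - x).
Proof.
move=> fdf xy; have [|c] := @MVT R f df x y xy (fun z _ => fdf z).
  apply: continuous_subspaceT => z; apply: differentiable_continuous.
  by apply/derivable1_diffP; have [] := fdf z.
by rewrite in_itv/=; exists c.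
Qed.

Lemma derive_le0_nonincreasing f df : (forall z : R, is_derive z 1 f (df z)) ->
  (forall z, df z <= 0) -> forall x y, x <= y -> f y <= f x.
Proof.
move=> fdf df0 x y; rewrite le_eqVlt => /predU1P[->//|xy].
have [c _ e] := derive_mean_value fdf xy.
have := df0 c; have : 0 < y - x by rewrite subr_gt0.
move: e; move: (df c) => k; nra.
Qed.

Lemma derive0_constant f : (forall z : R, is_derive z 1 f 0) -> forall x y, f x = f y.
Proof.
move=> fd x y; have [xy|yx|->//] := ltgtP x y.
  have [c _ e] := derive_mean_value fd xy; lra.
have [c _ e] := derive_mean_value fd yx; lra.
Qed.

Lemma nonincreasing_ge0_cvg f : (forall x y, x <= y -> f y <= f x) ->
  (forall x, 0 <= f x) -> exists l : R, f x @[x --> +oo] --> l.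
Proof.
move=> fmon f0.
have h : (\- f) x @[x --> +oo] --> sup (range (\- f)).
  apply: nondecreasing_cvgr; first by move=> x y /fmon xy; rewrite lerN2.
  by exists 0 => _ [x _ <-]; rewrite oppr_le0.
exists (- sup (range (\- f))).
have e : - (\- f) = f by apply/funext => x; exact: opprK.
by rewrite -{1}e; exact: cvgN h.
Qed.

(** The increment of [f] over an interval of length 1 tends to 0 and equals a value of [df] in that
    interval. Three errors below a quarter of [m] contradict [m != 0]. *)
Lemma cvg_derive_limit0 f df (l m : R) : (forall z : R, is_derive z 1 f (df z)) ->
  f x @[x --> +oo] --> l -> df x @[x --> +oo] --> m -> m = 0.
Proof.
move=> fdf fl dfm; apply/eqP/negP => /negP m0.
have e0 : 0 < `|m| / 4 by rewrite divr_gt0 ?normr_gt0.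
have /cvgrPdist_lt/(_ _ e0)[a [_ Ha]] := fl.
have /cvgrPdist_lt/(_ _ e0)[b [_ Hb]] := dfm.
pose x := Num.max a b + 1.
have [ax bx] : a < x /\ b < x.
  have h1 : a <= Num.max a b by rewrite le_max lexx.
  have h2 : b <= Num.max a b by rewrite le_max lexx orbT.
  by rewrite /x; split; lra.
have x1 : x < x + 1 by rewrite ltrDl.
have [c /andP[c1 c2] e'] := derive_mean_value fdf x1.
have e : f (x + 1) - f x = df c by rewrite e'; ring.
have h1 : `|l - f x| < `|m| / 4 := Ha x ax.
have h2 : `|l - f (x + 1)| < `|m| / 4 by apply: Ha; lra.
have h3 : `|m - df c| < `|m| / 4 by apply: Hb; lra.
have : `|m| <= `|m - df c| + (`|l - f x| + `|l - f (x + 1)|).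
  rewrite -[X in `|X| <= _](subrK (df c)) -e.
  apply: le_trans (ler_normD _ _) _; rewrite lerD2l.
  by rewrite (_ : f (x + 1) - f x = (l - f x) - (l - f (x + 1))) ?ler_normB//; ring.
lra.
Qed.

End RealFunctions.

Section FsetSums.
Context {R : realType} {Omega : choiceType}.

Lemma sum_fset_delta (F : {fset Omega}) (f : Omega -> R) i : i \in F ->
  \sum_(k <- F) (i == k)%:R * f k = f i.
Proof.
move=> iF; rewrite (bigD1_seq i)//= eqxx mul1r big1 ?addr0// => k ki.
by rewrite eq_sym (negPf ki) mul0r.
Qed.

Lemma le_sum_fset (F F' : {fset Omega}) (f : Omega -> R) : (F `<=` F')%fset ->
  (forall i, 0 <= f i) -> \sum_(i <- F) f i <= \sum_(i <- F') f i.
Proof.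
move=> FF' f0.
rewrite (_ : \sum_(i <- F) f i = \sum_(i <- F) if i \in F then f i else 0).
  rewrite (big_fset_incl _ FF'); last by move=> i _ /negPf->.
  by apply: ler_sum => i _; case: ifP.
by apply: eq_big_seq => i ->.
Qed.

End FsetSums.

Section FiniteChain.
Context {R : realType} {Omega : choiceType}.
Variable gamma : Omega -> Omega -> R.
Hypothesis gamma_ge0 : forall i j, 0 <= gamma i j.
Hypothesis gamma_diag : forall i, gamma i i = 0.
Variable X : Omega -> R.
Hypothesis X0 : forall i, 0 < X i.
Hypothesis X_rev : forall i j, X j * gamma j i = X i * gamma i j.
Variable F : {fset Omega}.

Let B := generator_on gamma F.

Let B_out i j : (i \notin F) || (j \notin F) -> B i j = 0.
Proof. by rewrite -negb_and /B /generator_on => /negPf->. Qed.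

Let b := \sum_(i <- F) \sum_(j <- F) `|B i j|.

Lemma generator_on_row_le i : (\esum_(j in [set: Omega]) `|B i j|%:E <= b%:E)%E.
Proof.
rewrite (esum_fset_support (F := F)) => [| |j jF]; last 2 first.
- by move=> j; rewrite lee_fin.
- by rewrite B_out ?normr0// jF orbT.
rewrite sumEFin lee_fin; have [iF|iF] := boolP (i \in F).
  rewrite /b [leRHS](bigD1_seq i)//= lerDl; apply: sumr_ge0 => k _.
  by apply: sumr_ge0.
rewrite big1; first by apply: sumr_ge0 => k _; apply: sumr_ge0.
by move=> j _; rewrite B_out ?normr0// iF.
Qed.

Let bound := matpow_bound1 generator_on_row_le.

Definition finite_apply (v : Omega -> R) i := \sum_(k <- F) B i k * v k.

(** The sum runs over [F] only; it is the exponential applied to [v] when [v] vanishes outside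
    [F]. *)
Definition flow (v : Omega -> R) (t : R) i := \sum_(j <- F) matexp t B i j * v j.

Lemma flow0 v i : i \in F -> flow v 0 i = v i.
Proof.
move=> iF; rewrite /flow -[RHS](sum_fset_delta _ iF); apply: eq_bigr => j _.
by rewrite matexp0.
Qed.

Lemma flowD v w t i : flow (fun j => v j + w j) t i = flow v t i + flow w t i.
Proof. by rewrite /flow -big_split/=; apply: eq_bigr => j _; rewrite mulrDr. Qed.

Lemma flowN v t i : flow (fun j => - v j) t i = - flow v t i.
Proof. by rewrite /flow -sumrN; apply: eq_bigr => j _; rewrite mulrN. Qed.

Lemma is_derive_flow v (t : R) i :
  is_derive t 1 (fun s => flow v s i) (finite_apply (flow v t) i).
Proof.
rewrite (_ : finite_apply _ i =
    \sum_(j <- F) v j * exps (fun n => matpow B n.+1 i j) t).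
  apply: (@is_derive_sumr _ _ _ (fun j s => matexp s B i j * v j)) => j.
  rewrite (_ : (fun s => _) = v j \*: (fun s => matexp s B i j)); last first.
    by apply/funext => s; rewrite mulrC.
  apply: is_deriveZ; exact: is_derive_exps (bound i j).
rewrite /finite_apply /flow.
under eq_bigr do rewrite mulr_sumr.
rewrite exchange_big/=; apply: eq_bigr => j _.
rewrite (eq_exps (d := fun n => \sum_(k <- F) B i k * matpow B n k j)).
  rewrite (exps_sum _ _ _ (fun k => bound k j)) mulr_sumr.
  by apply: eq_bigr => k _; rewrite mulrA mulrC.
move=> n; rewrite -[LHS]/(matpow B n.+1 i j) matpowS (usum_fset_support (F := F))//.
by move=> k kF; rewrite B_out ?mul0r// kF orbT.
Qed.

(** Conductance of the link, symmetric by [X_rev]. *)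
Let c i k := X k * gamma k i.

(** In terms of the density [w / X], the generator is a graph Laplacian with conductances [c]. *)
Lemma finite_applyE w i : i \in F ->
  finite_apply w i = \sum_(k <- F) c i k * (w k / X k - w i / X i).
Proof.
move=> iF; rewrite /finite_apply.
have -> : \sum_(k <- F) B i k * w k =
    \sum_(k <- F) (gamma k i * w k - (i == k)%:R * (\sum_(f <- F) gamma k f * w k)).
  apply: eq_big_seq => k kF; rewrite /B /generator_on iF kF/=.
  case: eqVneq => [<-|_]; last by rewrite mul0r subr0.
  by rewrite gamma_diag mul0r sub0r mul1r mulNr mulr_suml.
rewrite sumrB (sum_fset_delta (fun k => \sum_(f <- F) gamma k f * w k) iF) -sumrB.
apply: eq_bigr => k _; rewrite mulrBr; congr (_ - _).
  by rewrite /c; field; rewrite gt_eqF.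
by rewrite /c X_rev; field; rewrite gt_eqF.
Qed.

(** Summation by parts: the double sum is averaged with its transpose. Self-adjointness, decay of
    energy, the shape of stationary vectors and the conserved quantities are all read off this
    formula. *)
Lemma finite_apply_form (f w : Omega -> R) :
  2 * \sum_(i <- F) f i * finite_apply w i =
  - \sum_(i <- F) \sum_(k <- F) c i k * ((f i - f k) * (w i / X i - w k / X k)).
Proof.
have e1 : \sum_(i <- F) f i * finite_apply w i =
    \sum_(i <- F) \sum_(k <- F) c i k * (f i * (w k / X k - w i / X i)).
  apply: eq_big_seq => i iF; rewrite finite_applyE// mulr_sumr.
  by apply: eq_bigr => k _; rewrite mulrCA.
have e2 : \sum_(i <- F) f i * finite_apply w i =
    \sum_(i <- F) \sum_(k <- F) c i k * (f k * (w i / X i - w k / X k)).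
  rewrite e1 exchange_big/=; apply: eq_bigr => k _; apply: eq_bigr => i _.
  by rewrite /c X_rev.
rewrite (_ : 2 = 1 + 1 :> R)// mulrDl mul1r {1}e1 e2 -big_split/= -sumrN.
apply: eq_bigr => i _; rewrite -big_split/= -sumrN; apply: eq_bigr => k _.
ring.
Qed.

Definition inner (v w : Omega -> R) := \sum_(i <- F) v i / X i * w i.

Lemma inner_apply v w : inner v (finite_apply w) = inner (finite_apply v) w.
Proof.
have h2 : (2 : R) != 0 by rewrite pnatr_eq0.
apply: (mulfI h2); rewrite [in LHS]/inner finite_apply_form.
have -> : inner (finite_apply v) w = \sum_(i <- F) w i / X i * finite_apply v i.
  by apply: eq_bigr => i _; ring.
rewrite finite_apply_form; congr (- _); apply: eq_bigr => i _; apply: eq_bigr => k _.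
by rewrite [(w i / X i - _) * _]mulrC.
Qed.

Lemma inner_apply_le0 w : 2 * inner w (finite_apply w) <= 0.
Proof.
rewrite /inner finite_apply_form oppr_le0; apply: sumr_ge0 => i _.
apply: sumr_ge0 => k _; apply: mulr_ge0; last by rewrite -expr2 sqr_ge0.
by rewrite mulr_ge0// ltW.
Qed.

Lemma is_derive_inner (v w dv dw : R -> Omega -> R) (t : R) :
  (forall i, is_derive t 1 (v ^~ i) (dv t i)) ->
  (forall i, is_derive t 1 (w ^~ i) (dw t i)) ->
  is_derive t 1 (fun s => inner (v s) (w s)) (inner (dv t) (w t) + inner (v t) (dw t)).
Proof.
move=> hv hw; rewrite /inner -big_split/=.
apply: (@is_derive_sumr _ _ _ (fun i s => v s i / X i * w s i)) => i.
rewrite (_ : (fun s => _) = (X i)^-1 \*: ((v ^~ i) * (w ^~ i))); last first.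
  by apply/funext => s; rewrite /GRing.scale/= mulrAC mulrC.
have -> : dv t i / X i * w t i + v t i / X i * dw t i =
    (X i)^-1 *: (v t i *: dw t i + w t i *: dv t i).
  by rewrite /GRing.scale/=; ring.
by apply: is_deriveZ; apply: is_deriveM.
Qed.

(** By self-adjointness, the inner product of the flows at times [s] and [t - s] has zero derivative
    in [s]. This takes the place of the semigroup law. *)
Lemma inner_flow v w t : inner v (flow w t) = inner (flow v (t / 2)) (flow w (t / 2)).
Proof.
pose f s := inner (flow v s) (flow w (t - s)).
have d (s : R) : is_derive s 1 f 0.
  have -> : 0 = inner (finite_apply (flow v s)) (flow w (t - s)) +
      inner (flow v s) (fun i => - finite_apply (flow w (t - s)) i).
    rewrite -inner_apply /inner -big_split/= big1// => i _; ring.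
  apply: (is_derive_inner (dv := fun s i => finite_apply (flow v s) i)
    (dw := fun s i => - finite_apply (flow w (t - s)) i)) => i.
    exact: is_derive_flow.
  have hs : is_derive s 1 (fun s => t - s) (- 1 : R).
    rewrite -[- 1]add0r (_ : (fun s => _) = cst t - id)//.
    exact: is_deriveB.
  have := @is_derive1_comp _ (fun u => flow w u i) (fun s => t - s) s _ _
    (is_derive_flow w (t - s) i) hs.
  by rewrite mulrN1.
have := derive0_constant d 0 (t / 2); rewrite /f subr0.
rewrite (_ : t - t / 2 = t / 2); last by field.
move=> <-; apply: eq_big_seq => i iF; by rewrite flow0.
Qed.

Lemma flow_cvg v i : i \in F -> exists l : R, flow v t i @[t --> +oo] --> l.
Proof.
move=> iF.
pose En w t := inner (flow w (t / 2)) (flow w (t / 2)).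
have EnE w t : En w t = inner w (flow w t) by rewrite inner_flow.
have Ecvg w : exists l : R, En w t @[t --> +oo] --> l.
  apply: nonincreasing_ge0_cvg; last first.
    move=> t; apply: sumr_ge0 => k _; rewrite mulrAC -expr2 divr_ge0 ?sqr_ge0//.
    exact: ltW.
  move=> x y xy.
  have xy2 : x / 2 <= y / 2 by rewrite ler_pM2r.
  apply: (@derive_le0_nonincreasing _ (fun t => inner (flow w t) (flow w t))
    (fun t => inner (finite_apply (flow w t)) (flow w t) +
              inner (flow w t) (finite_apply (flow w t)))) => // z.
    apply: (is_derive_inner (dv := fun s i => finite_apply (flow w s) i)
      (dw := fun s i => finite_apply (flow w s) i)) => k; exact: is_derive_flow.
  by rewrite -inner_apply -mulr2n -mulr_natl inner_apply_le0.
(* The inner product with [e] extracts entry [i] divided by [X i]; polarization writes it as a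
   difference of two convergent energies. *)
pose e k : R := (i == k)%:R.
have [l1 h1] := Ecvg (fun k => e k + v k).
have [l2 h2] := Ecvg (fun k => e k - v k).
exists (X i * (4^-1 * (l1 - l2))).
rewrite (_ : (fun t => flow v t i) =
  fun t => X i * (4^-1 * (En (fun k => e k + v k) t - En (fun k => e k - v k) t))).
  by apply: cvgMr; apply: cvgMr; exact: cvgB.
apply/funext => t.
have -> : flow v t i = X i * inner e (flow v t).
  rewrite /inner.
  under eq_bigr do rewrite -mulrA.
  rewrite (sum_fset_delta (fun k => (X k)^-1 * flow v t k) iF) mulrA mulfV ?mul1r//.
  by rewrite gt_eqF.
congr (_ * _); rewrite inner_flow /En /inner -sumrB mulr_sumr.
apply: eq_bigr => k _; rewrite !flowD flowN; field.
by rewrite gt_eqF.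
Qed.

Definition flow_limit v i := lim (flow v t i @[t --> +oo]).

Lemma flow_cvg_limit v i : i \in F -> flow v t i @[t --> +oo] --> flow_limit v i.
Proof. by move=> /(flow_cvg v)[l h]; rewrite /flow_limit (cvg_lim _ h). Qed.

Lemma cvg_sum_fset (f : Omega -> R -> R) (l : Omega -> R) :
  (forall i, i \in F -> f i t @[t --> +oo] --> l i) ->
  \sum_(i <- F) f i t @[t --> +oo] --> \sum_(i <- F) l i.
Proof.
move=> h; rewrite big_seq.
under eq_cvg do rewrite big_seq.
by apply: cvg_big => //; exact: add_continuous.
Qed.

Lemma flow_limit_stationary v i : i \in F -> finite_apply (flow_limit v) i = 0.
Proof.
move=> iF.
refine (@cvg_derive_limit0 R (fun t => flow v t i) (fun t => finite_apply (flow v t) i) _ _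
  (fun t => is_derive_flow v t i) (flow_cvg_limit (v := v) iF) _).
apply: (@cvg_sum_fset (fun k t => B i k * flow v t k)) => k kF.
by apply: cvgMr; exact: flow_cvg_limit.
Qed.

(** Tested against its own density, the stationary limit makes a sum of nonnegative terms vanish,
    one for each ordered pair of states. *)
Lemma flow_limit_ratio v i k : i \in F -> k \in F -> 0 < gamma i k ->
  flow_limit v i / X i = flow_limit v k / X k.
Proof.
move=> iF kF gik.
have := finite_apply_form (fun i => flow_limit v i / X i) (flow_limit v).
rewrite [X in _ * X]big_seq big1; last first.
  by move=> j jF; rewrite flow_limit_stationary// mulr0.
rewrite mulr0 => /esym/eqP; rewrite oppr_eq0.
have T0 j l : 0 <= c j l * ((flow_limit v j / X j - flow_limit v l / X l) *
    (flow_limit v j / X j - flow_limit v l / X l)).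
  by rewrite -expr2 mulr_ge0 ?sqr_ge0// mulr_ge0// ltW.
rewrite psumr_eq0; last by move=> j _; apply: sumr_ge0.
move=> /allP/(_ i iF)/=; rewrite psumr_eq0// => /allP/(_ k kF)/=.
rewrite mulf_eq0 [X in _ || X]mulf_eq0 orbb subr_eq0 => /orP[|/eqP//].
by rewrite /c X_rev mulf_eq0 !gt_eqF.
Qed.

(** Functions constant along the links in [F] give conserved quantities, which pass to the limit.
    The relevant ones are indicators of components and their complements. *)
Lemma flow_limit_invariant (f v : Omega -> R) :
  (forall i k, i \in F -> k \in F -> 0 < gamma i k -> f i = f k) ->
  \sum_(i <- F) f i * flow_limit v i = \sum_(i <- F) f i * v i.
Proof.
move=> hf; pose m t := \sum_(i <- F) f i * flow v t i.
have d (t : R) : is_derive t 1 m 0.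
  have -> : 0 = \sum_(i <- F) f i * finite_apply (flow v t) i.
    have h2 : (2 : R) != 0 by rewrite pnatr_eq0.
    apply: (mulfI h2); rewrite finite_apply_form mulr0 big_seq big1 ?oppr0// => i iF.
    rewrite big_seq big1// => k kF.
    have [g0|g0] := eqVneq (gamma i k) 0.
      by rewrite /c X_rev g0 mulr0 mul0r.
    by rewrite (hf i k) ?subrr ?mul0r ?mulr0// lt_def g0 gamma_ge0.
  apply: (@is_derive_sumr _ _ _ (fun i s => f i * flow v s i)) => i.
  have -> : (fun s => f i * flow v s i) = f i \*: (fun s => flow v s i) by [].
  by apply: is_deriveZ; exact: is_derive_flow.
have m1 : m t @[t --> +oo] --> \sum_(i <- F) f i * flow_limit v i.
  apply: (@cvg_sum_fset (fun i t => f i * flow v t i)) => i iF.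
  by apply: cvgMr; exact: flow_cvg_limit.
have m2 : m t @[t --> +oo] --> m 0.
  rewrite (_ : m = cst (m 0)); first exact: cvg_cst.
  by apply/funext => t; exact: derive0_constant.
rewrite -[LHS](cvg_lim _ m1)// (cvg_lim _ m2)//.
by apply: eq_big_seq => i iF; rewrite flow0.
Qed.

Definition connected_in (i j : Omega) : Prop :=
  exists2 p : seq Omega, path (fun k l => 0 < gamma k l) i p &
    {subset i :: p <= F} /\ last i p = j.

Lemma connected_in_refl i : i \in F -> connected_in i i.
Proof. by move=> iF; exists [::] => //; split => // k; rewrite inE => /eqP->. Qed.

Lemma connected_in_mem i j : connected_in i j -> j \in F.
Proof. by move=> [p _ [sub <-]]; apply: sub; exact: mem_last. Qed.

Lemma connected_in_step i j k : connected_in i j -> k \in F -> 0 < gamma j k ->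
  connected_in i k.
Proof.
move=> [p hp [sub lp]] kF jk; exists (rcons p k).
  by rewrite rcons_path hp lp.
split; last by rewrite last_rcons.
move=> l; rewrite inE mem_rcons inE => /or3P[/eqP->|/eqP->//|lp'].
  by apply: sub; rewrite mem_head.
by apply: sub; rewrite inE lp' orbT.
Qed.

Definition component (i j : Omega) : R := `[< connected_in i j >]%:R.

Lemma component_invariant i j k : j \in F -> k \in F -> 0 < gamma j k ->
  component i j = component i k.
Proof.
move=> jF kF jk; rewrite /component.
have kj : 0 < gamma k j.
  by rewrite -(pmulr_rgt0 _ (X0 k)) X_rev mulr_gt0.
congr ((nat_of_bool _)%:R); apply/asboolP/asboolP => h.
  exact: connected_in_step h _ jk.
exact: connected_in_step h _ kj.
Qed.

Lemma connected_in_ratio v i j : connected_in i j ->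
  flow_limit v j / X j = flow_limit v i / X i.
Proof.
move=> [p hp [sub <-]] {j}; elim: p i hp sub => //= k p IH i /andP[ik kp] sub.
have kp_sub : {subset k :: p <= F} by move=> l lk; apply: sub; rewrite inE lk orbT.
rewrite (IH k)// -(flow_limit_ratio v _ _ ik)//; apply: sub.
  by rewrite mem_head.
by rewrite !inE eqxx orbT.
Qed.

(** The density of the limit is constant on the component of [i], and conservation of the mass of
    that component fixes the constant. *)
Lemma flow_limitE v i : i \in F ->
  flow_limit v i * (\sum_(j <- F) component i j * X j) =
  X i * \sum_(j <- F) component i j * v j.
Proof.
move=> iF; rewrite -(@flow_limit_invariant (component i) v); last exact: component_invariant.
rewrite !mulr_sumr; apply: eq_bigr => j _; rewrite /component.
case: asboolP => [h|_]; last by rewrite !mul0r !mulr0.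
rewrite !mul1r.
have -> : flow_limit v j = flow_limit v j / X j * X j by rewrite divfK// gt_eqF.
by rewrite (connected_in_ratio v h) mulrA mulrCA mulfV ?mulr1// gt_eqF.
Qed.

End FiniteChain.

(** * Thermodynamic limit *)

Section ThermodynamicLimit.
Context {R : realType} {Omega : choiceType}.
Variable gamma : Omega -> Omega -> R.
Hypothesis gamma_ge0 : forall i j, 0 <= gamma i j.
Hypothesis gamma_diag : forall i, gamma i i = 0.
Variable X : Omega -> R.
Hypothesis X0 : forall i, 0 < X i.
Hypothesis X_rev : forall i j, X j * gamma j i = X i * gamma i j.

Lemma limit_onE F (v : Omega -> R) : (forall i, i \notin F -> v i = 0) ->
  limit_on gamma F v = flow_limit gamma F v.
Proof.
move=> vF; apply/funext => i; rewrite /limit_on /flow_limit.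
rewrite (_ : (fun t => matvec _ _ _) = fun t => flow gamma F v t i)//.
apply/funext => t.
by rewrite /matvec (usum_fset_support (F := F))// => j /vF->; rewrite mulr0.
Qed.

(** All matrix powers, including the identity, have entry 0 from a state of [F] to one outside. *)
Lemma flow_limit_out (F : {fset Omega}) (v : Omega -> R) i : i \notin F ->
  flow_limit gamma F v i = 0.
Proof.
move=> iF; rewrite /flow_limit; apply: cvg_lim => //.
rewrite (_ : (fun t => flow _ _ _ _ _) = cst 0); first exact: cvg_cst.
apply/funext => t; rewrite /flow big_seq big1// => j jF.
rewrite [matexp _ _ _ _](_ : _ = 0) ?mul0r//.
have m0 n : matpow (generator_on gamma F) n i j = 0.
  case: n => [|n].
    by rewrite /matpow/= /matid; case: eqVneq => // ij; rewrite ij jF in iF.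
  rewrite matpowS (usum_fset_support (F := fset0)) ?big_seq_fset0// => k _.
  by rewrite /generator_on (negPf iF) mul0r.
rewrite -[LHS]/(exps (fun n => matpow (generator_on gamma F) n i j) t).
apply: cvg_lim => //; rewrite (_ : series _ = cst 0); first exact: cvg_cst.
by apply/funext => n; rewrite /series/= big1// => k _; rewrite m0 mulr0.
Qed.

Lemma prob_vector_mass_gt (Q : Omega -> R) (e : R) : prob_vector Q -> 0 < e ->
  exists F : {fset Omega}, 1 - e < mass Q F.
Proof.
move=> PQ e0; apply: contrapT => /forallNP H.
have : (\esum_(i in [set: Omega]) (Q i)%:E <= (1 - e)%:E)%E.
  apply: esum_le_fset => F; rewrite sumEFin lee_fin leNgt; apply/negP; exact: H.
rewrite prob_vector_esum// lee_fin; lra.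
Qed.

Lemma mass_le1 (Q : Omega -> R) F : prob_vector Q -> mass Q F <= 1.
Proof.
move=> PQ; rewrite -lee_fin -(prob_vector_esum PQ); apply: esum_ge_fset.
by case: PQ.
Qed.

Lemma connected_in_sub (F F' : {fset Omega}) i j : (F `<=` F')%fset ->
  connected_in gamma F i j -> connected_in gamma F' i j.
Proof.
move=> /fsubsetP FF' [p hp [sub lp]]; exists p => //; split => // k /sub.
exact: FF'.
Qed.

Lemma finite_connected_superset (o : Omega) (F : {fset Omega}) : irreducible gamma ->
  exists F1 : {fset Omega}, forall i, i \in F -> connected_in gamma F1 o i.
Proof.
move=> irr.
have aux (s : seq Omega) :
    exists F1 : {fset Omega}, forall i, i \in s -> connected_in gamma F1 o i.
  elim: s => [|i s [F1 HF1]]; first by exists fset0.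
  have [p hp lp] := irr o i.
  exists (F1 `|` [fset k in o :: p])%fset => k; rewrite inE => /predU1P[->|ks].
    by exists p => //; split => // l lp'; rewrite !inE/= -in_cons lp' orbT.
  by apply: connected_in_sub (HF1 k ks); exact: fsubsetUl.
exact: aux F.
Qed.

Variable Q : Omega -> R.
Hypothesis PQ : prob_vector Q.
Variable m : R.
Hypothesis m0 : 0 < m.
Hypothesis QE : forall i, Q i = X i / m.

Variables (P0 : Omega -> R) (o : Omega) (F0 F : {fset Omega}) (e : R).
Hypothesis PP0 : prob_vector P0.
Hypothesis F_mass : 0 < mass P0 F.
Hypothesis F0_connected : forall i, i \in F0 -> connected_in gamma F o i.
Hypothesis F0_P0 : 1 - e <= mass P0 F0.
Hypothesis F0_Q : 1 - e <= mass Q F0.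
Hypothesis e_lt1 : e < 1.

(** The component of [o] contains [F0], so [Q] and the restricted [P0] give it masses [pC] and [vC]
    of at least [1 - e]. On it the limit is [Q] rescaled by [vC / pC]. The errors [|vC - pC|],
    [1 - vC] and [1 - pC] are at most [e] each, so [4 * e] leaves room. *)
Lemma limit_on_close :
  (l1norm (limit_on gamma F (restrict_prob P0 F) \- Q)%R <= (4 * e)%:E)%E.
Proof.
have [Q0 _] := PQ; have [P00 _] := PP0.
have arith (x y : R) : x <= 1 -> 1 - e <= x -> y <= 1 -> 1 - e <= y ->
    `|x - y| + (1 - x) <= 3 * e.
  move=> x1 xe y1 ye; have : `|x - y| <= e; last lra.
  by rewrite ler_norml; apply/andP; split; lra.
have F0F : (F0 `<=` F)%fset.
  by apply/fsubsetP => i /F0_connected; exact: connected_in_mem.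
pose v := restrict_prob P0 F.
have vF i : i \in F -> v i = P0 i / mass P0 F by rewrite /v /restrict_prob => ->.
have v0 i : 0 <= v i.
  by rewrite /v /restrict_prob; case: ifP => // _; rewrite divr_ge0// ltW.
rewrite limit_onE; last by move=> i iF; rewrite /restrict_prob (negPf iF).
rewrite -/v; pose L := flow_limit gamma F v; rewrite -/L.
pose phi := component gamma F o.
have phi01 i : 0 <= phi i <= 1 by rewrite /phi /component; case: asboolP; rewrite ?lexx ?ler01.
have phi0 i : 0 <= phi i by have /andP[] := phi01 i.
have phi1 i : 0 <= 1 - phi i by have /andP[_] := phi01 i; rewrite subr_ge0.
have phi_out i : i \notin F -> phi i = 0.
  rewrite /phi /component; case: asboolP => // /connected_in_mem ->//.
have phi_F0 i : i \in F0 -> phi i = 1.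
  by rewrite /phi /component => /F0_connected h; case: asboolP.
have component0 i j : 0 <= component gamma F i j by rewrite /component.
have L0 i : 0 <= L i.
  have [iF|iF] := boolP (i \in F); last by rewrite /L flow_limit_out.
  have pos : 0 < \sum_(j <- F) component gamma F i j * X j.
    rewrite (bigD1_seq i)//= ltr_pwDl//.
      rewrite /component; case: asboolP; first by rewrite mul1r.
      by move=> []; exact: connected_in_refl.
    by apply: sumr_ge0 => j _; rewrite mulr_ge0// ltW.
  rewrite -(pmulr_lge0 _ pos) /L flow_limitE//.
  by rewrite mulr_ge0 ?(ltW (X0 i))// sumr_ge0// => j _; rewrite mulr_ge0.
pose vC := \sum_(i <- F) phi i * v i.
pose pC := \sum_(i <- F) phi i * Q i.
have sub_sum (f : Omega -> R) : (forall i, 0 <= f i) ->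
    \sum_(i <- F0) f i <= \sum_(i <- F) phi i * f i.
  move=> f0; rewrite (_ : \sum_(i <- F0) f i = \sum_(i <- F0) phi i * f i).
    by apply: le_sum_fset => // i; rewrite mulr_ge0.
  by apply: eq_big_seq => i /phi_F0->; rewrite mul1r.
have vsum : \sum_(i <- F) v i = 1.
  rewrite (eq_big_seq (fun i => P0 i / mass P0 F))// -mulr_suml mulfV//.
  by rewrite gt_eqF.
have phi_le (f : Omega -> R) : (forall i, 0 <= f i) ->
    \sum_(i <- F) phi i * f i <= \sum_(i <- F) f i.
  move=> f0; apply: ler_sum => i _; rewrite ler_piMl//.
  by have /andP[] := phi01 i.
have vC1 : vC <= 1 by rewrite -vsum; exact: phi_le.
(* Dividing by [mass P0 F], which is at most 1, only increases the entries. *)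
have vCe : 1 - e <= vC.
  apply: le_trans F0_P0 _; apply: le_trans (sub_sum v v0).
  rewrite /mass big_seq [leRHS]big_seq; apply: ler_sum => i iF0.
  rewrite vF ?(fsubsetP F0F)// ler_pdivlMr// ler_piMr//; exact: mass_le1.
have pC1 : pC <= 1 by apply: le_trans (phi_le Q Q0) _; exact: mass_le1.
have pCe : 1 - e <= pC by apply: le_trans F0_Q _; exact: sub_sum.
have pC0 : 0 < pC by apply: lt_le_trans pCe; rewrite subr_gt0.
have L_phi i : phi i != 0 -> L i = Q i * (vC / pC).
  rewrite /phi /component; case: asboolP => [h _|]; last by rewrite eqxx.
  have iF := connected_in_mem h.
  have oF : o \in F by case: h => p _ [sub _]; apply: sub; rewrite mem_head.
  have pCX : pC = (\sum_(j <- F) phi j * X j) / m.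
    by rewrite mulr_suml; apply: eq_bigr => j _; rewrite QE mulrA.
  have pX : 0 < \sum_(j <- F) phi j * X j.
    by move: pC0; rewrite pCX pmulr_lgt0// invr_gt0.
  have Lo : L o = X o * (vC / (\sum_(j <- F) phi j * X j)).
    rewrite mulrA -(flow_limitE gamma_ge0 gamma_diag X0 X_rev v oF) mulfK//.
    by rewrite gt_eqF.
  have r : L i / X i = L o / X o.
    exact: (connected_in_ratio gamma_ge0 gamma_diag X0 X_rev).
  have -> : L i = L i / X i * X i by rewrite divfK// gt_eqF.
  rewrite r Lo QE pCX; field; rewrite !gt_eqF//.
(* [a] collects the rescaling error on the component and the limit off it, [b] the part of [Q] off
   it. *)
pose a i := phi i * Q i * (`|vC - pC| / pC) + (1 - phi i) * L i.
pose b i := Q i - phi i * Q i.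
have a0 i : 0 <= a i.
  apply: addr_ge0; first by apply: mulr_ge0; [exact: mulr_ge0|rewrite divr_ge0// ltW].
  exact: mulr_ge0.
have b0 i : 0 <= b i.
  by rewrite subr_ge0 ler_piMl//; have /andP[] := phi01 i.
have Lab i : `|L i - Q i| <= a i + b i.
  have [p0|p0] := eqVneq (phi i) 0.
    rewrite /a /b p0 !mul0r add0r !subr0 mul1r.
    by apply: le_trans (ler_normB _ _) _; rewrite !ger0_norm.
  have p1 : phi i = 1 by move: p0; rewrite /phi /component; case: asboolP; rewrite ?eqxx.
  rewrite /a /b p1 subrr mul0r !mul1r subrr !addr0 (L_phi _ p0).
  rewrite -[X in _ - X]mulr1 -mulrBr normrM (ger0_norm (Q0 i)).
  rewrite (_ : vC / pC - 1 = (vC - pC) / pC); last by field; rewrite gt_eqF.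
  by rewrite normrM (gtr0_norm (_ : 0 < pC^-1)) ?invr_gt0.
have aE : \esum_(i in [set: Omega]) (a i)%:E = (`|vC - pC| + (1 - vC))%:E.
  rewrite (esum_fset_support (F := F)).
  - rewrite sumEFin big_split/= -mulr_suml mulrC divfK; last by rewrite gt_eqF.
    congr (_ + _)%:E.
    have := @flow_limit_invariant _ _ _ gamma_ge0 gamma_diag _ X0 X_rev F
      (fun i => 1 - phi i) v.
    rewrite -/L => ->; last first.
      by move=> i k iF kF ik; rewrite /phi (component_invariant X0 X_rev o iF kF ik).
    under eq_bigr do rewrite mulrBl mul1r.
    by rewrite sumrB vsum.
  - by move=> i; rewrite lee_fin.
  - move=> i iF; rewrite /a phi_out// mul0r mul0r add0r subr0 mul1r /L.
    by rewrite flow_limit_out.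
have phiQ : \esum_(i in [set: Omega]) (phi i * Q i)%:E = pC%:E.
  rewrite (esum_fset_support (F := F)) ?sumEFin//.
  - by move=> i; rewrite lee_fin mulr_ge0.
  - by move=> i iF; rewrite phi_out// mul0r.
have bE : (\esum_(i in [set: Omega]) (b i)%:E + pC%:E = 1)%E.
  rewrite -phiQ -esumD.
  - rewrite -(prob_vector_esum PQ); apply: eq_esum => i _.
    by rewrite -EFinD subrK.
  - by move=> i _; rewrite lee_fin.
  - by move=> i _; rewrite lee_fin mulr_ge0.
have -> : (4 * e)%:E = ((3 * e)%:E + e%:E)%E by rewrite -EFinD; congr (_%:E); ring.
apply: (@le_trans _ _ (\esum_(i in [set: Omega]) ((a i)%:E + (b i)%:E)%E)).
  by apply: le_esum => i _; rewrite -EFinD lee_fin; exact: Lab.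
rewrite esumD//; try by move=> i _; rewrite lee_fin.
apply: leeD.
  by rewrite aE lee_fin; exact: arith.
move: bE pCe; case: (\esum_(i in _) _) => [x| |]//=.
by rewrite -EFinD lee_fin => -[] h1 h2; rewrite -(lerD2r pC) h1 -lerBlDl.
Qed.

End ThermodynamicLimit.

Theorem theorem26 (R : realType) (Omega : choiceType)
    (Omega_countably_infinite : ([set: Omega] #= [set: nat])%card)
    (gamma : Omega -> Omega -> R)
    (gamma_ge0 : forall i j, 0 <= gamma i j)
    (gamma_diag : forall i, gamma i i = 0)
    (Gamma_summable : abs_summable (generator gamma))
    (Hirr : irreducible gamma)
    (Hrec : positive_recurrent (generator gamma))
    (Hgdb : generalized_detailed_balance gamma) :
  exists Pstar : Omega -> R,
    unique (stationary (generator gamma)) Pstar /\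
    forall P0 : Omega -> R, prob_vector P0 ->
      l1norm (limit_on gamma F (restrict_prob P0 F) \- Pstar)
        @[F --> finite_net P0] --> 0%E.

Proof.
have [a row_le] := generator_row_le Gamma_summable.
have col_fin := generator_col_fin Gamma_summable.
have [X X0 Xdb] := Hgdb.
have X_rev i j : X j * gamma j i = X i * gamma i j.
  by have [->//|ij] := eqVneq i j; exact: Xdb.
have G_rev i j : X j * generator gamma i j = X i * generator gamma j i.
  by rewrite /generator eq_sym; case: eqVneq => [->|_].
have G_irr i j : exists2 p : seq Omega,
    path (fun k l => 0 < generator gamma l k) i p & last i p = j.
  have [p hp lp] := Hirr i j; exists p => //; apply: sub_path hp => k l kl.
  rewrite /generator; case: eqVneq => // lk.
  by move: kl; rewrite lk gamma_diag ltxx.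
have [i0 _] : exists i : Omega, True.
  have /card_set_bijP[f] := Omega_countably_infinite.
  by rewrite setTT_bijective => -[g _ _]; exists (g 0%N).
have [M X_le] := reversible_mass_le Omega_countably_infinite row_le col_fin X0 G_rev
  Hrec G_irr i0.
have [m m0 SP] := normalized_stationary gamma_ge0 gamma_diag Gamma_summable X0 X_rev
  X_le i0.
exists (fun i => X i / m); split.
  split=> // Q SQ.
  exact: (stationary_unique gamma_ge0 gamma_diag Gamma_summable Hirr).
have [PP _] := SP.
move=> P0 PP0 U HU0.
(* [U] is a neighbourhood in the extended reals; its finite points suffice since the norms are
   bounded by [4 * e]. *)
have [r r0 HU] : exists2 r : R, 0 < r & forall x : R, `|x| < r -> U x%:E.
  have [r /= r0 H] : nbhs (0 : R) (fun x => U x%:E) by exact: HU0.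
  by exists r => // x xr; apply: H; rewrite /= sub0r normrN.
(* [r / 8] makes [4 * e < r]; the bound 1/2 keeps [1 - e] positive, and with it the masses of [F1]
   and of the component. *)
pose e := Num.min (r / 8) 2^-1.
have e0 : 0 < e by rewrite lt_min invr_gt0 ltr0n andbT; exact: divr_gt0.
have er : 4 * e < r.
  have : e <= r / 8 by rewrite /e ge_min lexx.
  lra.
have e1 : e < 1.
  have : e <= 2^-1 by rewrite /e ge_min lexx orbT.
  lra.
have [H1 hH1] := prob_vector_mass_gt PP0 e0.
have [H2 hH2] := prob_vector_mass_gt PP e0.
(* The union of [H1] and [H2] may be disconnected; [F1] adds paths from [i0] to its states, and
   every larger set keeps them. *)
have [F1 HF1] := finite_connected_superset i0 (H1 `|` H2)%fset Hirr.
have [P00 _] := PP0; have [PP_ge0 _] := PP.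
have H1F : (H1 `<=` H1 `|` H2)%fset by exact: fsubsetUl.
have H2F : (H2 `<=` H1 `|` H2)%fset by exact: fsubsetUr.
have HF : (H1 `|` H2 `<=` F1)%fset.
  by apply/fsubsetP => i /HF1; exact: connected_in_mem.
have c1 : 1 - e <= mass P0 (H1 `|` H2)%fset.
  by apply: le_trans (ltW hH1) _; exact: le_sum_fset.
have c2 : 1 - e <= mass (fun i => X i / m) (H1 `|` H2)%fset.
  by apply: le_trans (ltW hH2) _; exact: le_sum_fset.
exists F1.
  rewrite /=; apply: (@lt_le_trans _ _ (1 - e)); first by rewrite subr_gt0.
  by apply: le_trans c1 _; exact: le_sum_fset.
move=> F /= [F_mass F1F].
have close := @limit_on_close _ _ _ gamma_ge0 gamma_diag _ X0 X_rev _ PP _ m0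
  (fun i => erefl) _ i0 _ F e PP0 F_mass
  (fun i iH => connected_in_sub F1F (HF1 i iH)) c1 c2 e1.
have : (0 <= l1norm (limit_on gamma F (restrict_prob P0 F) \- (fun i => X i / m))%R)%E.
  by apply: esum_ge0 => i _; rewrite lee_fin.
move: close; case: (l1norm _) => [x| |]//=.
rewrite !lee_fin => xe x0; apply: HU.
by rewrite ger0_norm//; exact: le_lt_trans er.
Qed.
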